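(* Let $\mathcal{M}$ be an MDP with integer weights and designated absorbing state $\mathit{goal}$, and let $b\in\mathbb{R}$ be arbitrary. The optimal partial expectation with bias $b$, $\mathit{PE}^{\sup}_{s_{\mathit{init}}}[b]$, is finite if and only if there are no positively weight-divergent end components in $\mathcal{M}$.
   Context: A Markov decision process (MDP) is a tuple $\mathcal{M}=(S,\mathit{Act},P,s_{\mathit{init}},\mathit{wgt})$ with finite state set $S$, finite action set $\mathit{Act}$, initial state $s_{\mathit{init}}$, $P:S\times\mathit{Act}\times S\to[0,1]\cap\mathbb{Q}$ with $\sum_{t}P(s,\alpha,t)\in\{0,1\}$, and $\mathit{wgt}:S\times\mathit{Act}\to\mathbb{Z}$. $\mathit{Act}(s)$ is the (nonempty) set of actions $\alpha$ enabled in $s$, i.e. with $\sum_tP(s,\alpha,t)=1$. All states are assumed reachable from $s_{\mathit{init}}$. A state is absorbing if its only enabled action leads back to it with probability $1$ and weight $0$. A path is an alternating sequence $s_0\alpha_0s_1\alpha_1\dots$ with $P(s_i,\alpha_i,s_{i+1})>0$; for a finite path $\pi$, $\mathit{wgt}(\pi)$ is the sum of the weights of its steps. A scheduler assigns to every finite path $\pi$ a probability distribution on $\mathit{Act}(\mathit{last}(\pi))$, where $\mathit{last}(\pi)$ is the last state; $\Pr^{\mathfrak{S}}_{s}$ and $\mathbb{E}^{\mathfrak{S}}_s$ denote the induced measure on infinite paths from $s$ and its expectation. $\Diamond(\mathit{wgt}\ge n)$ is the set of infinite paths having a prefix of weight at least $n$. Standing assumption: there is a designated absorbing state $\mathit{goal}$,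 and all states from which $\mathit{goal}$ is not reachable are collapsed to one absorbing state $\mathit{fail}$. For $b\in\mathbb{R}$, the random variable $\oplus^b\mathit{goal}$ has value $\mathit{wgt}(\zeta)+b$ on infinite paths $\zeta$ that reach $\mathit{goal}$ (with $\mathit{wgt}(\zeta)$ the weight accumulated until $\mathit{goal}$) and $0$ on all other paths. $\mathit{PE}^{\mathfrak{S}}_{s}[b]=\mathbb{E}^{\mathfrak{S}}_{s}(\oplus^b\mathit{goal})$ and $\mathit{PE}^{\sup}_{s}[b]=\sup_{\mathfrak{S}}\mathit{PE}^{\mathfrak{S}}_{s}[b]$ over all schedulers. An end component is a pair $\mathcal{E}=(E,\mathfrak{A})$ with $\emptyset\ne E\subseteq S$ and $\emptyset\neq\mathfrak{A}(s)\subseteq\mathit{Act}(s)$ for $s\in E$, forming a sub-MDP (all successors under actions of $\mathfrak{A}$ stay in $E$) whose induced graph is strongly connected. It is positively weight-divergent if there is a scheduler $\mathfrak{S}$ for $\mathcal{E}$ with $\Pr^{\mathfrak{S}}_{\mathcal{E},s}(\Diamond(\mathit{wgt}\ge n))=1$ for all $s\in E$ and all $n\in\mathbb{N}$. *)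

(* Defs.v *)
From HB Require Import structures.
From mathcomp Require Import all_boot all_order all_algebra.
From mathcomp Require Import all_classical all_reals all_analysis.

Set Implicit Arguments.
Unset Strict Implicit.
Unset Printing Implicit Defensive.

Import Order.TTheory GRing.Theory Num.Theory.

Local Open Scope classical_set_scope.
Local Open Scope ring_scope.

Record mdp := Mdp {
  state : finType;
  act : finType;
  trans : state -> act -> state -> rat;
  init : state;
  weight : state -> act -> int;
  trans_01 : forall s a t, 0 <= trans s a t <= 1;
  trans_sum : forall s a,
    \sum_t trans s a t = 0 \/ \sum_t trans s a t = 1;
  enabled_ex : forall s, exists a, \sum_t trans s a t == 1 }.

Arguments trans {m}.
Arguments weight {m}.

Section Mdp.
Variable M : mdp.
Implicit Types (s t : state M) (a : act M) (h : seq (state M * act M)).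
Implicit Types (E : {set state M}) (A : state M -> {set act M}).

Definition enabled s : {set act M} := [set a | \sum_t trans s a t == 1]%SET.

Definition absorbing s : Prop :=
  exists a, [/\ enabled s = [set a]%SET, trans s a s = 1 & weight s a = 0].

(* [(E, A)] stands for the sub-MDP with states [E] and actions [A s] in
   [s \in E]; the whole MDP is [([set: state M], enabled)]. *)
Definition edge E A : rel (state M) :=
  [rel s t | (s \in E) && [exists a in A s, 0 < trans s a t]].

Definition reach s t : bool := connect (edge [set: state M]%SET enabled) s t.

(* There need not be a fail state: none exists when [goal] can be reached from
   everywhere, since all states are assumed reachable from [init]. *)
Definition fail_collapsed (goal : state M) : Prop :=
  (forall s, ~~ reach s goal -> absorbing s) /\
  (forall s t, ~~ reach s goal -> ~~ reach t goal -> s = t).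

(* The finite path s_0 a_0 ... s_(n-1) a_(n-1) s_n is the pair of
   [h = [:: (s_0, a_0); ...; (s_(n-1), a_(n-1))]] and [t = s_n]. *)
Definition first_state h t : state M := head t (unzip1 h).

Fixpoint is_path h t : bool :=
  if h is (s, a) :: h' then
    (0 < trans s a (first_state h' t)) && is_path h' t
  else true.

Definition is_path_in E A h t : bool :=
  [&& all [pred x | (x.1 \in E) && (x.2 \in A x.1)] h, t \in E & is_path h t].

Definition end_component E A : Prop :=
  [/\ E != finset.set0,
      (forall s, s \in E -> A s != finset.set0 /\ A s \subset enabled s),
      (forall s a t, s \in E -> a \in A s -> 0 < trans s a t -> t \in E) &
      (forall s t, s \in E -> t \in E -> connect (edge E A) s t)].

(* The sample space consists of all sequences of state-action pairs; under an
   induced measure the sequences that are not paths form a null set. *)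
Definition run : Type := nat -> state M * act M.

HB.instance Definition _ := Choice.on run.
HB.instance Definition _ :=
  isPointed.Build run (fun=> (init M, xchoose (enabled_ex (init M)))).

Definition cylinder h t : set run :=
  [set z | mkseq z (size h) = h /\ (z (size h)).1 = t].

Definition cylinders : set (set run) :=
  [set C | exists h t, C = cylinder h t].

Definition runs := g_sigma_algebraType cylinders.

Definition wgt_upto (z : run) (k : nat) : int :=
  \sum_(i < k) weight (z i).1 (z i).2.

Definition wgt_reaches (n : nat) : set runs :=
  [set z | exists k, n%:Z <= wgt_upto z k].

Section Real.
Variable R : realType.

(* [sigma h t a] is the probability of choosing [a] after the finite path
   [(h, t)]; the values of [sigma] on other pairs [(h, t)] are irrelevant. *)
Definition sched : Type :=
  seq (state M * act M) -> state M -> act M -> R.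

Implicit Types (sigma : sched) (mu : probability runs R).

Definition is_scheduler_in E A sigma : Prop :=
  forall h t, is_path_in E A h t ->
    [/\ forall a, 0 <= sigma h t a,
        \sum_a sigma h t a = 1 &
        forall a, a \notin A t -> sigma h t a = 0].

Definition is_scheduler sigma : Prop :=
  is_scheduler_in [set: state M]%SET enabled sigma.

Fixpoint path_prob sigma (past h : seq (state M * act M)) t : R :=
  if h is (s, a) :: h' then
    sigma past s a * ratr (trans s a (first_state h' t))
      * path_prob sigma (rcons past (s, a)) h' t
  else 1.

(* [mu] is the measure induced by [sigma] from [s]; it is unique, since the
   cylinders are pairwise nested or disjoint. *)
Definition induces sigma s mu : Prop :=
  forall h t, mu (cylinder h t) =
    ((first_state h t == s)%:R * path_prob sigma [::] h t)%:E.

Definition pos_weight_divergent E A : Prop :=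
  exists2 sigma, is_scheduler_in E A sigma &
    forall s, s \in E ->
      exists2 mu, induces sigma s mu &
        forall n : nat, mu (wgt_reaches n) = 1%E.

Definition oplus (goal : state M) (b : R) (z : runs) : R :=
  match pselect (exists k, (z k).1 == goal) with
  | left reach_goal => (wgt_upto z (ex_minn reach_goal))%:~R + b
  | right _ => 0
  end.

(* If the positive and the negative part of [oplus goal b] both have infinite
   expectation, then ['E_mu[oplus goal b]] is [+oo - +oo = -oo], so that
   schedulers with an undefined expectation do not affect the supremum. *)
Definition PE_sup (goal s : state M) (b : R) : \bar R :=
  ereal_sup [set x : \bar R | exists sigma mu,
    [/\ is_scheduler sigma, induces sigma s mu &
        x = 'E_mu[oplus goal b]%E]].

End Real.
End Mdp.

Arguments pos_weight_divergent {M} R E A.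

(* Main.v *)
Require Import Defs.
From HB Require Import structures.
From mathcomp Require Import all_boot all_order all_algebra.
From mathcomp Require Import all_classical all_reals all_analysis.
From mathcomp Require Import measurable_realfun.
From mathcomp Require Import ring lra zify.

(** If no end component is positively weight-divergent, there is a potential [u]
    on states such that every enabled pair (s, a) either has negative expected
    increment of [wgt + u], or has increment 0 for every successor. For small
    [th > 0] the process [exp (th * (wgt + u))] is then a supermartingale under
    every scheduler, which bounds the positive part of the partial expectation.

    The potential comes from Farkas' lemma. The alternative is a stationary
    flow on state-action pairs whose support contains an end component on which
    [wgt + u] has nonnegative drift, for some [u], but is not constant along
    paths. On it path weights are unbounded above: otherwise the supremum of the
    weights of the paths from a state would differ from [u] by a harmonic,
    hence constant, function. By a maximum principle the uniform memoryless
    scheduler then exceeds every weight almost surely.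

    Conversely, from a positively weight-divergent end component one can
    accumulate an arbitrarily high weight before moving towards [goal] along
    shortest paths, which costs a bounded weight on average. *)

Set Implicit Arguments.
Unset Strict Implicit.
Unset Printing Implicit Defensive.

Import Order.TTheory GRing.Theory Num.Theory.
Import numFieldNormedType.Exports.

Local Open Scope classical_set_scope.
Local Open Scope ring_scope.

(** * Random infinite words with prescribed conditional distributions *)

(** The dichotomy for the potential is forced by the exponential: a pair whose increment of
    [wgt + u] has mean 0 without being constant would make [expR (th * (wgt + u))] increase on
    average for every [th > 0], by Jensen's inequality. Linear programming alone only yields a mean
    of at most 0; that no fluctuating pair of mean 0 remains is a further use of the absence of
    divergent end components.

    Weights are unbounded in both directions and the expectation of a payoff may be undefined. Its
    positive and negative parts are therefore estimated separately, each as a monotone limit of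
    recursions over a finite horizon ([goal_value], and likewise [hit] for reaching a weight), so
    that the estimates are inductions on the horizon.

    Both [PE_sup] and [pos_weight_divergent] speak of measures that must exist before anything can
    be concluded from a scheduler. The induced measure is the image of Lebesgue measure on the unit
    interval under an expansion of reals into words, in the manner of digits. *)

Section RandomWord.
Variables (R : realType) (X : finType) (x0 : X) (K : seq X -> X -> R).
Hypothesis K_ge0 : forall h x, 0 <= K h x.
Hypothesis K_sum : forall h, \sum_x K h x = 1.

Fixpoint word_prob (past h : seq X) : R :=
  if h is x :: h' then K past x * word_prob (rcons past x) h' else 1.

Lemma word_prob_rcons past h x :
  word_prob past (rcons h x) = word_prob past h * K (past ++ h) x.
Proof.
elim: h past => [|y h IH] past /=; first by rewrite cats0 mulr1 mul1r.
by rewrite IH cat_rcons mulrA.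
Qed.

Lemma word_prob_ge0 past h : 0 <= word_prob past h.
Proof. by elim: h past => [|x h IH] past //=; rewrite mulr_ge0. Qed.

Definition cum h (j : nat) : R := \sum_(y | (enum_rank y < j)%N) K h y.

Lemma cum_rank h x : cum h (enum_rank x).+1 = cum h (enum_rank x) + K h x.
Proof.
rewrite /cum (bigD1 x) ?leqnn //= addrC; congr (_ + _).
apply: eq_bigl => y; rewrite ltnS [RHS]ltn_neqAle andbC.
by rewrite -(inj_eq enum_rank_inj).
Qed.

Lemma cum_homo h : {homo cum h : i j / (i <= j)%N >-> i <= j}.
Proof.
move=> i j ij; rewrite /cum [leRHS](bigID (fun y : X => (enum_rank y < i)%N)) /=.
rewrite [X in _ <= X + _](eq_bigl (fun y : X => (enum_rank y < i)%N)); last first.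
  move=> y; case: (ltnP (enum_rank y) i) => yi; rewrite ?andbF //.
  by rewrite (leq_trans yi ij).
by rewrite lerDl sumr_ge0.
Qed.

Lemma cum0 h : cum h 0 = 0. Proof. by rewrite /cum big_pred0. Qed.

Lemma cum_card h : cum h #|X| = 1.
Proof. by rewrite -(K_sum h); apply: eq_bigl => y; rewrite ltn_ord. Qed.

(* [bnd] runs through the reversed word. *)
Fixpoint bnd (r : seq X) : R :=
  if r is x :: r' then
    bnd r' + word_prob [::] (rev r') * cum (rev r') (enum_rank x)
  else 0.

Definition word_lo h := bnd (rev h).

Lemma word_lo_rcons h x :
  word_lo (rcons h x) = word_lo h + word_prob [::] h * cum h (enum_rank x).
Proof. by rewrite /word_lo rev_rcons /= revK. Qed.

(* The words of a given length partition [0, 1[ into the intervals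
   [word_itv h], whose lengths are the probabilities of the words. *)
Definition word_itv h (u : R) : bool :=
  word_lo h <= u < word_lo h + word_prob [::] h.

Lemma word_itv_rcons h x u : word_itv (rcons h x) u =
  (word_lo h + word_prob [::] h * cum h (enum_rank x) <= u <
   word_lo h + word_prob [::] h * cum h (enum_rank x).+1).
Proof.
by rewrite /word_itv word_lo_rcons word_prob_rcons cum_rank mulrDr addrA.
Qed.

Lemma word_itv_next h u : word_itv h u -> exists x, word_itv (rcons h x) u.
Proof.
move=> /andP[lo hi].
(* The next letter is the one of rank [j.-1], for the least [j] whose right endpoint exceeds [u];
   [j = 0] is impossible since [cum h 0 = 0]. *)
have ex : exists j, u < word_lo h + word_prob [::] h * cum h j.
  by exists #|X|; rewrite cum_card mulr1.
case: (ex_minnP ex) => j uj minj.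
case: j uj minj => [|j] uj minj.
  by move: uj; rewrite cum0 mulr0 addr0 ltNge lo.
have jX : (j < #|X|)%N by apply: minj; rewrite cum_card mulr1.
exists (enum_val (Ordinal jX)); rewrite word_itv_rcons enum_valK /= uj andbT.
by rewrite leNgt; apply/negP => /minj; rewrite ltnn.
Qed.

Lemma word_itv_inj h x y u :
  word_itv (rcons h x) u -> word_itv (rcons h y) u -> x = y.
Proof.
wlog xy : x y / (enum_rank x <= enum_rank y)%N.
  move=> W hx hy; case/orP: (leq_total (enum_rank x) (enum_rank y)) => c.
    exact: W.
  by apply/esym; exact: W.
rewrite !word_itv_rcons => /andP[_ ux] /andP[uy _].
apply: enum_rank_inj; apply: val_inj; apply/eqP => /=.
rewrite eqn_leq xy /= leqNgt; apply/negP => lt_xy.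
have := le_lt_trans uy ux; rewrite ltrD2l => /lt_geF/negP; apply.
by rewrite ler_wpM2l ?word_prob_ge0 // cum_homo.
Qed.

Lemma word_itv_rconsW h x u : word_itv (rcons h x) u -> word_itv h u.
Proof.
rewrite word_itv_rcons => /andP[lo hi]; apply/andP; split.
  by apply: le_trans lo; rewrite lerDl mulr_ge0 ?word_prob_ge0 // -(cum0 h) cum_homo.
apply: lt_le_trans hi _; rewrite lerD2l -{2}[word_prob _ _]mulr1.
by rewrite ler_wpM2l ?word_prob_ge0 // -(cum_card h) cum_homo.
Qed.

(** The digits of [u]. The default [x0] is met only for [u] outside [0, 1[. *)
Fixpoint word_of (u : R) (n : nat) : seq X :=
  if n is n'.+1 then
    let h := word_of u n' in
    rcons h (odflt x0 [pick x | word_itv (rcons h x) u])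
  else [::].

Lemma word_of_itv u n : 0 <= u < 1 -> word_itv (word_of u n) u.
Proof.
move=> u01; elim: n => [|n IH] /=; first by rewrite /word_itv /word_lo /= add0r.
case: pickP => //= none; have [x] := word_itv_next IH.
by rewrite none.
Qed.

(** The words with prefix [h] come from an interval of length [word_prob [::] h], which is why the
    image of Lebesgue measure has the prescribed probabilities. *)
Lemma word_itv_of u h : 0 <= u < 1 -> word_itv h u = (word_of u (size h) == h).
Proof.
move=> u01; apply/idP/eqP => [|<-]; last exact: word_of_itv.
elim/last_ind: h => // h x IH hu; rewrite size_rcons /= IH; last exact: word_itv_rconsW hu.
case: pickP => /= [y hy|/(_ x)]; last by rewrite hu.
by rewrite (word_itv_inj hy hu).
Qed.

Definition letters (u : R) (n : nat) : X := last x0 (word_of u n.+1).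

Lemma mkseq_letters u n : mkseq (letters u) n = word_of u n.
Proof.
elim: n => //= n IH; rewrite /mkseq -addn1 iotaD map_cat -/(mkseq _ _) IH cats1.
by rewrite /letters /= last_rcons.
Qed.
End RandomWord.

(** * Existence of the induced measure *)

Section Basics.
Variables (R : realType) (M : mdp).
Implicit Types (s t : state M) (a : act M) (h past : seq (state M * act M)).
Implicit Types (E : {set state M}) (A : state M -> {set act M}).

Definition prob s a t : R := ratr (trans s a t).

Lemma prob_ge0 s a t : 0 <= prob s a t.
Proof. by rewrite /prob ler0q; case/andP: (trans_01 s a t). Qed.

Lemma prob_gt0 s a t : (0 < prob s a t) = (0 < trans s a t).
Proof. by rewrite /prob ltr0q. Qed.

Lemma prob_eq0 s a t : ~~ (0 < trans s a t) -> prob s a t = 0.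
Proof.
by rewrite -prob_gt0 lt_neqAle prob_ge0 andbT negbK => /eqP.
Qed.

Lemma enabledE s a : (a \in enabled s) = (\sum_t trans s a t == 1).
Proof. by rewrite /enabled !inE. Qed.

Lemma prob_sum s a : a \in enabled s -> \sum_t prob s a t = 1.
Proof. by rewrite enabledE => /eqP e; rewrite /prob -rmorph_sum /= e rmorph1. Qed.

Lemma trans_enabled s a t : 0 < trans s a t -> a \in enabled s.
Proof.
rewrite enabledE => p0; case: (trans_sum s a) => [e|->//].
have t0 : trans s a t = 0.
  by apply: (psumr_eq0P _ e) => // i _; case/andP: (trans_01 s a i).
by move: p0; rewrite t0 ltxx.
Qed.

Lemma enabled_trans s a : a \in enabled s -> exists t, 0 < trans s a t.
Proof.
rewrite enabledE => /eqP e; apply: contrapT => none.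
move: e; rewrite big1 => [/eqP|t _]; first by rewrite eq_sym oner_eq0.
apply/eqP; apply: contrapT => /negP p0; apply: none; exists t.
by rewrite lt_neqAle eq_sym p0; case/andP: (trans_01 s a t).
Qed.

Lemma first_state_rcons h s a t :
  first_state (rcons h (s, a)) t = first_state h s.
Proof. by case: h => [|[]]. Qed.

Lemma is_path_rcons h s a t :
  is_path (rcons h (s, a)) t = is_path h s && (0 < trans s a t).
Proof.
elim: h => [|[s' a'] h IH] /=; first by rewrite andbT.
by rewrite IH first_state_rcons andbA.
Qed.

Lemma is_path_in_rcons E A h s a t : is_path_in E A (rcons h (s, a)) t =
  [&& is_path_in E A h s, a \in A s, 0 < trans s a t & t \in E].
Proof.
rewrite /is_path_in all_rcons is_path_rcons /=.
by case: (s \in E); case: (a \in A s); case: (all _ _); case: (t \in E);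
  case: (is_path _ _); case: (0 < _).
Qed.

Lemma path_prob_rcons (sigma : sched M R) past h s a t :
  path_prob sigma past (rcons h (s, a)) t =
  path_prob sigma past h s * (sigma (past ++ h) s a * prob s a t).
Proof.
elim: h past => [|[s' a'] h IH] past /=; first by rewrite cats0 mul1r mulr1.
by rewrite first_state_rcons IH cat_rcons !mulrA.
Qed.

Lemma is_path_enabled h t :
  is_path_in [set: state M]%SET (@enabled M) h t = is_path h t.
Proof.
rewrite /is_path_in inE /= andbC; case p: is_path => //=.
elim: h p => [//|[s a] h IH] /= /andP[p0 /IH ->].
by rewrite inE (trans_enabled p0).
Qed.

Lemma path_prob_path (sigma : sched M R) past h t :
  ~~ is_path h t -> path_prob sigma past h t = 0.
Proof.
elim: h past => [//|[s a] h IH] past /=; rewrite negb_and => /orP[p0|np].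
  by rewrite -/(prob _ _ _) prob_eq0 // mulr0 mul0r.
by rewrite IH // mulr0.
Qed.
End Basics.

Section InducedMeasure.
Variables (R : realType) (M : mdp) (sigma : sched M R) (s0 : state M).
Hypothesis sigma_sched : is_scheduler sigma.
Implicit Types (s t : state M) (a : act M) (h : seq (state M * act M)).

Let x0 : state M * act M := (init M, xchoose (enabled_ex (init M))).

(** A letter bundles the successor drawn from the preceding pair with the action that [sigma] then
    chooses in it; [s0] is the only first state of positive probability. *)
Definition raw_kernel h (x : state M * act M) : R :=
  (if h is y :: h' then prob R (last y h').1 (last y h').2 x.1
   else (x.1 == s0)%:R) * sigma h x.1 x.2.

Definition is_distr (p : state M * act M -> R) :=
  (forall x, 0 <= p x) /\ \sum_x p x = 1.

(* [raw_kernel h] is a distribution only if [h] is a path. *)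
Definition kernel h (x : state M * act M) : R :=
  if pselect (is_distr (raw_kernel h)) then raw_kernel h x
  else (x == x0)%:R.

Lemma kernel_distr h : is_distr (kernel h).
Proof.
rewrite /kernel; case: pselect => [//|nd] /=; split=> //.
by rewrite (bigD1 x0) //= eqxx big1 ?addr0 // => y /negbTE ->.
Qed.

Lemma raw_kernel_rcons h s a t b :
  raw_kernel (rcons h (s, a)) (t, b) = prob R s a t * sigma (rcons h (s, a)) t b.
Proof.
rewrite /raw_kernel /=; case E: (rcons h (s, a)) => [|y h'].
  by move/(congr1 size): E; rewrite size_rcons.
have := congr1 (last (s, a)) E; rewrite last_rcons /= => <-.
by rewrite -E.
Qed.

Lemma raw_kernel_distr h s a :
  is_path h s -> a \in enabled s -> is_distr (raw_kernel (rcons h (s, a))).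
Proof.
move=> hs a_s; have S t : 0 < trans s a t ->
    is_path_in [set: state M]%SET (@enabled M) (rcons h (s, a)) t.
  by rewrite is_path_enabled is_path_rcons hs.
split=> [[t b]|].
  rewrite raw_kernel_rcons; have [p0|/prob_eq0 ->] := boolP (0 < trans s a t).
    by rewrite mulr_ge0 ?prob_ge0 //; case: (sigma_sched (S _ p0)).
  by rewrite mul0r.
rewrite -(pair_big xpredT xpredT (fun t b => raw_kernel (rcons h (s, a)) (t, b))) /=.
rewrite -(prob_sum R a_s); apply: eq_bigr => t _.
under eq_bigr do rewrite raw_kernel_rcons.
rewrite -mulr_sumr; have [p0|/prob_eq0 ->] := boolP (0 < trans s a t).
  by case: (sigma_sched (S _ p0)) => _ -> _; rewrite mulr1.
by rewrite mul0r.
Qed.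

Lemma raw_kernel_nil_distr : is_distr (raw_kernel [::]).
Proof.
have [ge0 sum1 _] : [/\ forall a, 0 <= sigma [::] s0 a,
    \sum_a sigma [::] s0 a = 1 & forall a, a \notin enabled s0 -> sigma [::] s0 a = 0].
  by apply: sigma_sched; rewrite is_path_enabled.
split=> [[t b]|]; rewrite /raw_kernel /=.
  by case: eqP => [->|_]; rewrite ?mul1r ?mul0r.
rewrite -(pair_big xpredT xpredT (fun t b => (t == s0)%:R * sigma [::] t b)) /=.
rewrite (bigD1 s0) //= eqxx [X in _ + X]big1 ?addr0 => [|t /negbTE ->].
  by rewrite -mulr_sumr mul1r.
by rewrite -mulr_sumr mul0r.
Qed.

(** The replacement made in [kernel] leaves no trace: it can occur only after a word that is not a
    path or that ends with a disabled action, and there both sides are 0. *)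
Lemma word_prob_kernel h t a : word_prob kernel [::] (rcons h (t, a)) =
  (first_state h t == s0)%:R * path_prob sigma [::] h t * sigma h t a.
Proof.
elim/last_ind: h t a => [|h [s a] IH] t b.
  rewrite /= mulr1 /kernel; case: pselect => [?|/(_ raw_kernel_nil_distr)//].
  by rewrite /raw_kernel mulr1.
rewrite word_prob_rcons IH /= first_state_rcons path_prob_rcons.
have [hs|/path_prob_path ->] := boolP (is_path h s); last by rewrite !(mul0r, mulr0).
have [a_s|a_s] := boolP (a \in enabled s); last first.
  have -> : sigma h s a = 0.
    by case: (sigma_sched (h := h) (t := s)) => [|_ _ ->//]; rewrite is_path_enabled.
  by rewrite !(mul0r, mulr0).
rewrite /kernel; case: pselect => [?|/(_ (raw_kernel_distr hs a_s))//].
by rewrite raw_kernel_rcons !mulrA.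
Qed.

Lemma word_prob_kernel_sum h t : \sum_a word_prob kernel [::] (rcons h (t, a)) =
  (first_state h t == s0)%:R * path_prob sigma [::] h t.
Proof.
under eq_bigr do rewrite word_prob_kernel.
rewrite -mulr_sumr; have [ht|/path_prob_path ->] := boolP (is_path h t).
  by case: (sigma_sched (h := h) (t := t)) => [|_ -> _]; rewrite ?is_path_enabled ?mulr1.
by rewrite mulr0 mul0r.
Qed.

Local Notation letter := (letters x0 kernel).

Definition sample (u : measurableTypeR R) : runs M :=
  if 0 <= u < 1 then letter u else (point : runs M).

(** A cylinder fixes its last state but not the action taken there, whereas words consist of whole
    pairs; hence a finite union, disjoint by [word_itv_inj]. *)
Definition cylinder_itv h t : set (measurableTypeR R) :=
  \bigcup_(a in [set: act M]) [set u | word_itv kernel (rcons h (t, a)) u].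

Lemma sample_cylinder h t (u : measurableTypeR R) : 0 <= u < 1 ->
  cylinder h t (sample u) <-> cylinder_itv h t u.
Proof.
have k_ge0 h' x : 0 <= kernel h' x by case: (kernel_distr h').
have k_sum h' : \sum_x kernel h' x = 1 by case: (kernel_distr h').
move=> u01; rewrite /sample u01 /cylinder_itv /cylinder /bigcup /=.
have W a : word_itv kernel (rcons h (t, a)) u <->
    mkseq (letter u) (size h) = h /\ letter u (size h) = (t, a).
  rewrite (@word_itv_of _ _ x0 kernel k_ge0 k_sum) // -mkseq_letters.
  rewrite size_rcons /mkseq -addn1 iotaD map_cat cats1 eqseq_rcons.
  by split=> [/andP[/eqP -> /eqP ->]|[-> ->]]; rewrite ?eqxx.
split=> [[hu ht]|[a _ ua]]; last by have [-> ->] := (W a).1 ua.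
exists (letter u (size h)).2 => //.
by apply: (W _).2; split; rewrite // -ht -surjective_pairing.
Qed.

Lemma measurable_word_itv h x :
  measurable ([set u | word_itv kernel (rcons h x) u] : set (measurableTypeR R)).
Proof.
rewrite (_ : [set _ | _] = [set` `[word_lo kernel (rcons h x),
   word_lo kernel (rcons h x) + word_prob kernel [::] (rcons h x)[]).
  exact: measurable_itv.
by apply/seteqP; split=> u; rewrite /= in_itv.
Qed.

Lemma measurable_cylinder_itv h t : measurable (cylinder_itv h t).
Proof.
apply: fin_bigcup_measurable => [|a _]; first exact: finite_finset.
exact: measurable_word_itv.
Qed.

Let D : set (measurableTypeR R) := [set` `[0, 1[].
Let mD : measurable D. Proof. exact: measurable_itv. Qed.

Let DE u : D u <-> 0 <= u < 1. Proof. by rewrite /D /= in_itv. Qed.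

Lemma cylinder_itv_sub h t : cylinder_itv h t `<=` D.
Proof.
have k_ge0 h' x : 0 <= kernel h' x by case: (kernel_distr h').
have k_sum h' : \sum_x kernel h' x = 1 by case: (kernel_distr h').
move=> u [a _] /=; move: (rcons h (t, a)) => w.
elim/last_ind: w => [|w x IH]; last by move/(word_itv_rconsW k_ge0 k_sum).
by rewrite /D /= in_itv /word_itv /word_lo /= add0r.
Qed.

Lemma measurable_sample : measurable_fun setT sample.
Proof.
apply: (@measurability _ _ (measurableTypeR R) (runs M) setT sample (@cylinders M)) => //.
move=> _ [_ [h [t ->]] <-]; rewrite setTI.
(* Outside [0, 1[ [sample] is constant, so there the preimage is everything or nothing. *)
rewrite (_ : _ @^-1` _ = cylinder_itv h t `|`
    (~` D `&` [set _ | cylinder h t (point : runs M)])); last first.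
  apply/seteqP; split=> [u cu|u [cu|[Du cp]]]; rewrite /preimage /=.
  - have [/DE u01|Du] := pselect (D u); first by left; apply/(sample_cylinder h t u01).
    right; split=> //; move: cu; rewrite /preimage /= /sample; case: ifP => // u01.
  - have /DE u01 := cylinder_itv_sub cu.
    exact/(sample_cylinder h t u01).
  - by rewrite /sample ifF //; apply/negP => /DE.
apply: measurableU; first exact: measurable_cylinder_itv.
apply: measurableI; first exact: measurableC.
have [cp|cp] := pselect (cylinder h t (point : runs M)).
  by rewrite (_ : [set _ | _] = setT) //; apply/seteqP; split.
by rewrite (_ : [set _ | _] = set0) //; apply/seteqP; split.
Qed.

Lemma lebesgue_cylinder_itv h t : lebesgue_measure (cylinder_itv h t) =
  ((first_state h t == s0)%:R * path_prob sigma [::] h t)%:E.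
Proof.
have k_ge0 h' x : 0 <= kernel h' x by case: (kernel_distr h').
rewrite -word_prob_kernel_sum /cylinder_itv measure_fin_bigcup; last 3 first.
- exact: finite_finset.
- move=> a b _ _ [u /= [ua ub]].
  by have [] := word_itv_inj k_ge0 ua ub.
- by move=> a _; exact: measurable_word_itv.
rewrite (_ : [set: act M] = [set` enum (act M)]); last first.
  by apply/seteqP; split=> a //= _; rewrite mem_enum.
rewrite -fsbig_seq ?enum_uniq // big_enum -sumEFin; apply: eq_bigr => a _.
rewrite (_ : [set _ | _] = [set` `[word_lo kernel (rcons h (t, a)),
   word_lo kernel (rcons h (t, a)) + word_prob kernel [::] (rcons h (t, a))[]);
  last by apply/seteqP; split=> u; rewrite /= in_itv.
apply: (etrans (lebesgue_measure_itv _)).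
rewrite /= lte_fin ltrDl lt_neqAle word_prob_ge0 // andbT.
case: eqP => /= [<-|_]; first by [].
by rewrite -EFinB addrAC subrr add0r.
Qed.

Definition path_measure : set (runs M) -> \bar R :=
  pushforward (mrestr (@lebesgue_measure R) mD) sample.

Let path_measure0 : path_measure set0 = 0%E.
Proof. by rewrite /path_measure /pushforward preimage_set0 measure0. Qed.

Let path_measure_ge0 X : (0 <= path_measure X)%E.
Proof. exact: (measure_ge0 (@lebesgue_measure R)). Qed.

Let path_measure_sigma_additive : semi_sigma_additive path_measure.
Proof.
move=> F mF tF mUF.
exact: (@measure_semi_sigma_additive _ _ _
  (pushforward (mrestr (@lebesgue_measure R) mD) (mfun_Sub (mem_set measurable_sample)))).
Qed.

HB.instance Definition _ := isMeasure.Build _ _ _ path_measure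
  path_measure0 path_measure_ge0 path_measure_sigma_additive.

Let path_measure_setT : path_measure [set: _] = 1%E.
Proof.
rewrite /path_measure /pushforward preimage_setT /mrestr setTI.
apply: (etrans (lebesgue_measure_itv _)); rewrite /=.
by rewrite lte_fin ltr01 sube0.
Qed.

HB.instance Definition _ := Measure_isProbability.Build _ _ _
  path_measure path_measure_setT.

(** Used in both directions: it turns every scheduler into a member of the supremum [PE_sup], and it
    supplies the measures that [pos_weight_divergent] asks for. *)
Theorem induced_measure_exists :
  exists mu : probability (runs M) R, induces sigma s0 mu.
Proof.
exists path_measure => h t.
rewrite -[LHS]/(lebesgue_measure (sample @^-1` cylinder h t `&` D)).
rewrite (_ : _ `&` _ = cylinder_itv h t) ?lebesgue_cylinder_itv //.
apply/seteqP; split=> u; first by case=> cu /DE u01; apply/(sample_cylinder h t u01).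
move=> cu; have Du := cylinder_itv_sub cu; split => //.
by move/DE: Du => u01; apply/(sample_cylinder h t u01).
Qed.

End InducedMeasure.

(** * Finite-horizon expectations *)

Section Step.
Variables (R : realType) (M : mdp).
Implicit Types (s t : state M) (a : act M) (p : act M -> R) (X Y : act M -> state M -> R).

Definition distr_on (B : {set act M}) p :=
  [/\ forall a, 0 <= p a, \sum_a p a = 1 & forall a, a \notin B -> p a = 0].

Definition step p s X : R := \sum_a p a * \sum_t prob R s a t * X a t.

Lemma step_le (B : {set act M}) p s X Y : distr_on B p ->
    (forall a t, a \in B -> 0 < trans s a t -> X a t <= Y a t) ->
  step p s X <= step p s Y.
Proof.
move=> [p0 _ pB] XY; apply: ler_sum => a _.
have [aB|/pB ->] := boolP (a \in B); last by rewrite !mul0r.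
rewrite ler_wpM2l //; apply: ler_sum => t _.
have [pt|/prob_eq0 ->] := boolP (0 < trans s a t); last by rewrite !mul0r.
by rewrite ler_wpM2l ?prob_ge0 // XY.
Qed.

Lemma eq_step (B : {set act M}) p s X Y : distr_on B p ->
    (forall a t, a \in B -> 0 < trans s a t -> X a t = Y a t) ->
  step p s X = step p s Y.
Proof.
by move=> pB XY; apply/eqP; rewrite eq_le !(step_le pB) // => a t aB pt; rewrite XY.
Qed.

Lemma step_cst (B : {set act M}) p s c : distr_on B p -> B \subset enabled s ->
  step p s (fun _ _ => c) = c.
Proof.
move=> [_ p1 pB] Bs; rewrite -[RHS]mul1r -p1 mulr_suml.
apply: eq_bigr => a _; have [/(fintype.subsetP Bs) a_s|/pB ->] := boolP (a \in B).
  by rewrite -mulr_suml prob_sum // mul1r.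
by rewrite !mul0r.
Qed.

Lemma step_ub (B : {set act M}) p s X c : distr_on B p -> B \subset enabled s ->
    (forall a t, a \in B -> 0 < trans s a t -> X a t <= c) ->
  step p s X <= c.
Proof. by move=> pB Bs Xc; rewrite -[leRHS](step_cst c pB Bs) (step_le pB). Qed.

Lemma step_lb (B : {set act M}) p s X c : distr_on B p -> B \subset enabled s ->
    (forall a t, a \in B -> 0 < trans s a t -> c <= X a t) ->
  c <= step p s X.
Proof. by move=> pB Bs Xc; rewrite -[leLHS](step_cst c pB Bs) (step_le pB). Qed.

Lemma step_eq_cst (B : {set act M}) p s X c : distr_on B p -> B \subset enabled s ->
    (forall a t, a \in B -> 0 < trans s a t -> X a t = c) ->
  step p s X = c.
Proof. by move=> pB Bs Xc; rewrite -[RHS](step_cst c pB Bs); apply: eq_step pB _. Qed.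

Lemma stepD p s X Y : step p s (fun a t => X a t + Y a t) = step p s X + step p s Y.
Proof.
rewrite /step -big_split; apply: eq_bigr => a _; rewrite /= -mulrDr -big_split.
by congr (_ * _); apply: eq_bigr => t _; rewrite mulrDr.
Qed.

Lemma stepZ p s c X : step p s (fun a t => c * X a t) = c * step p s X.
Proof.
rewrite /step mulr_sumr; apply: eq_bigr => a _; rewrite mulrCA; congr (_ * _).
by rewrite mulr_sumr; apply: eq_bigr => t _; rewrite mulrCA.
Qed.

Definition sub_mdp (E : {set state M}) (A : state M -> {set act M}) :=
  (forall s, s \in E -> A s \subset enabled s) /\
  (forall s a t, s \in E -> a \in A s -> 0 < trans s a t -> t \in E).

Lemma sub_mdp_enabled : sub_mdp [set: state M]%SET (@enabled M).
Proof. by split=> *; rewrite ?inE. Qed.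

Lemma end_component_sub_mdp E A : end_component E A -> sub_mdp E A.
Proof. by case=> _ EA cl _; split=> // s /EA[]. Qed.

Lemma is_path_in_last E A h t : is_path_in E A h t -> t \in E.
Proof. by case/and3P. Qed.

Section Schedule.
Variables (E : {set state M}) (A : state M -> {set act M}).
Hypothesis EA : sub_mdp E A.

Lemma is_path_in_extend h s a t : is_path_in E A h s -> a \in A s ->
  0 < trans s a t -> is_path_in E A (rcons h (s, a)) t.
Proof.
move=> hs aA pt; rewrite is_path_in_rcons hs aA pt /=.
by apply: EA.2 pt => //; exact: is_path_in_last hs.
Qed.

Fixpoint prefix_exp (sigma : sched M R) k past s (F : seq (state M * act M) -> state M -> R) : R :=
  if k is k'.+1 then
    step (sigma past s) s (fun a t => prefix_exp sigma k' (rcons past (s, a)) t F)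
  else F past s.

(** Lets a recursion stop early once the past has decided the value of [F], as [goal_value] does at
    [goal] and [hit] at its level. *)
Lemma prefix_exp_cst (sigma : sched M R) k past s F c :
    is_scheduler_in E A sigma -> is_path_in E A past s ->
    (forall h t, first_state h t = s -> F (past ++ h) t = c) ->
  prefix_exp sigma k past s F = c.
Proof.
move=> sg; elim: k past s => [|k IH] past s ps Fc /=.
  by have := Fc [::] s erefl; rewrite cats0.
apply: (step_eq_cst (sg _ _ ps)); first exact: EA.1 (is_path_in_last ps).
move=> a t aA pt; apply: IH; first exact: is_path_in_extend.
by move=> h t' _; rewrite cat_rcons Fc.
Qed.
End Schedule.
End Step.

(** * Payoffs at the goal over a finite horizon *)

Section GoalValue.
Variables (R : realType) (M : mdp) (goal : state M).
Implicit Types (s t : state M) (a : act M) (past h : seq (state M * act M)).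
Implicit Types (sigma : sched M R) (g : int -> R).

Definition word_wgt h : int := \sum_(x <- h) weight x.1 x.2.

Lemma word_wgt_rcons h s a : word_wgt (rcons h (s, a)) = word_wgt h + weight s a.
Proof. by rewrite /word_wgt big_rcons /= addrC. Qed.

Lemma word_wgt_cons h s a : word_wgt ((s, a) :: h) = weight s a + word_wgt h.
Proof. by rewrite /word_wgt big_cons. Qed.

(* The expectation of [g] at the weight accumulated until [goal], restricted to
   the runs that reach [goal] within [k] steps. *)
Fixpoint goal_value sigma k past s g : R :=
  if s == goal then g 0 else
  if k is k'.+1 then
    step (sigma past s) s (fun a t =>
      goal_value sigma k' (rcons past (s, a)) t (fun x => g (weight s a + x)))
  else 0.

Lemma goal_value_goal sigma k past g : goal_value sigma k past goal g = g 0.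
Proof. by case: k => [|k] /=; rewrite eqxx. Qed.

Lemma goal_valueS sigma k past s g : s != goal ->
  goal_value sigma k.+1 past s g =
  step (sigma past s) s (fun a t =>
      goal_value sigma k (rcons past (s, a)) t (fun x => g (weight s a + x))).
Proof. by move=> /negbTE sg /=; rewrite sg. Qed.

(** The list [p] has one state more than [h], so that a visit to [goal] exactly at step [size h]
    counts. *)
Definition prefix_payoff g h t : R :=
  let p := rcons (unzip1 h) t in
  if goal \in p then g (word_wgt (take (index goal p) h)) else 0.

Lemma prefix_payoff_goal g past h t :
  goal \notin unzip1 past -> first_state h t = goal ->
  prefix_payoff g (past ++ h) t = g (word_wgt past).
Proof.
move=> ngoal ht; rewrite /prefix_payoff.
have [q ->] : exists q, rcons (unzip1 (past ++ h)) t = unzip1 past ++ goal :: q.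
  rewrite /unzip1 map_cat rcons_cat; case: h ht => [|[s a] h] /=; rewrite /first_state /=.
    by move->; exists [::].
  by move->; exists (rcons (unzip1 h) t).
rewrite mem_cat inE eqxx orbT index_cat (negbTE ngoal) /= eqxx addn0 size_map.
by rewrite take_size_cat.
Qed.

Lemma prefix_exp_payoff sigma k past s g :
    is_scheduler sigma -> is_path past s -> goal \notin unzip1 past ->
  prefix_exp sigma k past s (prefix_payoff g) =
  goal_value sigma k past s (fun x => g (word_wgt past + x)).
Proof.
move=> sg; elim: k past s => [|k IH] past s ps ngoal;
  (case: (eqVneq s goal) => [e|sgoal]; first by
    rewrite e goal_value_goal addr0 in ps *;
    apply: (prefix_exp_cst (sub_mdp_enabled M) _ sg);
    [rewrite is_path_enabled | move=> h t; exact: prefix_payoff_goal]).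
- rewrite /= /prefix_payoff mem_rcons inE eq_sym (negbTE sgoal) /=.
  by rewrite (negbTE ngoal).
rewrite goal_valueS //=.
have := sg past s; rewrite is_path_enabled => /(_ ps) sgs.
apply: (eq_step sgs) => a t aA pt; rewrite IH.
- congr goal_value; apply/funext => x; congr g.
  by rewrite word_wgt_rcons addrA.
- by rewrite is_path_rcons ps.
- by rewrite /unzip1 map_rcons mem_rcons inE negb_or eq_sym sgoal.
Qed.
End GoalValue.

(** * Integrals of functions of a finite prefix and their monotone limits *)

Section PrefixIntegral.
Variables (R : realType) (M : mdp).
Implicit Types (s t : state M) (a : act M) (past h : seq (state M * act M)).
Local Notation X := (state M * act M)%type.

Lemma sum_tupleS k (G : seq X -> R) :
  \sum_(h : k.+1.-tuple X) G h = \sum_x \sum_(h : k.-tuple X) G (x :: h).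
Proof.
rewrite pair_bigA /=.
rewrite (reindex (fun p : X * k.-tuple X => [tuple of p.1 :: p.2])) //=.
exists (fun h : k.+1.-tuple X => (thead h, [tuple of behead h])) => [[x h] _|h _] /=.
  by congr (_, _); apply: val_inj.
by rewrite -tuple_eta.
Qed.

(** Connects the recursion with the cylinder probabilities, which are all that [induces] says about
    a measure. *)
Lemma prefix_exp_sum (sigma : sched M R) k past s F :
  \sum_(h : k.-tuple X) \sum_t
    (first_state h t == s)%:R * path_prob sigma past h t * F (past ++ h) t =
  prefix_exp sigma k past s F.
Proof.
elim: k past s => [|k IH] past s /=.
  rewrite (bigD1 [tuple]) //= [X in _ + X]big1 ?addr0 => [|h /eqP[]]; last by rewrite [h]tuple0.
  rewrite (bigD1 s) //= big1 ?addr0 => [|t /negbTE ts]; last by rewrite /first_state /= ts !mul0r.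
  by rewrite /first_state /= eqxx !mul1r cats0.
rewrite (sum_tupleS k (fun h => \sum_t
    (first_state h t == s)%:R * path_prob sigma past h t * F (past ++ h) t)).
transitivity (\sum_s' \sum_a \sum_(h : k.-tuple X) \sum_t
    (first_state ((s', a) :: h) t == s)%:R * path_prob sigma past ((s', a) :: h) t
       * F (past ++ (s', a) :: h) t).
  by rewrite [RHS]pair_bigA; apply: eq_bigr => -[].
rewrite (bigD1 s) //= [X in _ + X]big1 ?addr0 => [|s' /negbTE s's]; last first.
  by rewrite big1 // => a _; rewrite big1 // => h _; rewrite big1 // => t _;
    rewrite /first_state /= s's !mul0r.
apply: eq_bigr => a _.
under [in RHS]eq_bigr => t' _.
  rewrite -IH mulr_sumr; under eq_bigr do rewrite mulr_sumr.
  over.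
rewrite [in RHS]exchange_big /= mulr_sumr; apply: eq_bigr => h _.
rewrite [in RHS]exchange_big /= mulr_sumr; apply: eq_bigr => t _.
rewrite (bigD1 (first_state h t)) //= eqxx [X in _ + X]big1 ?addr0 => [|t' /negbTE t'h]; last first.
  by rewrite eq_sym t'h !mul0r mulr0.
by rewrite /first_state /= eqxx !mul1r -/(first_state h t) cat_rcons !mulrA.
Qed.

Lemma measurable_cylinder h t : measurable (cylinder h t : set (runs M)).
Proof. by apply: sub_sigma_algebra; exists h, t. Qed.

(** A function of a finite prefix is a simple function on cylinders; this gives its measurability
    and its integral at once. *)
Lemma prefix_indic_sum k (F : seq X -> state M -> R) (z : runs M) :
  (F (mkseq z k) (z k).1)%:E =
  (\sum_(p : k.-tuple X * state M) (F p.1 p.2)%:E * (\1_(cylinder p.1 p.2) z)%:E)%E.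
Proof.
have sz : size (mkseq z k) == k by rewrite size_mkseq.
rewrite (bigD1 (Tuple sz, (z k).1)) //= big1 ?adde0.
  by rewrite indicE mem_set ?mule1 //; split; rewrite size_mkseq.
move=> [h t] /= ht; rewrite indicE memNset ?mule0 //= => -[].
rewrite size_tuple => hz zt; move: ht; rewrite -zt.
by rewrite xpair_eqE eqxx andbT -val_eqE /= hz eqxx.
Qed.

Lemma measurable_prefix k (F : seq X -> state M -> R) :
  measurable_fun [set: runs M] (fun z : runs M => (F (mkseq z k) (z k).1)%:E).
Proof.
under eq_fun do rewrite prefix_indic_sum.
apply: emeasurable_sum => p; apply: emeasurable_funM => //.
by apply/measurable_EFinP; apply: measurable_indic; exact: measurable_cylinder.
Qed.

Lemma measurable_prefix_set k (P : seq X -> state M -> bool) :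
  measurable [set z : runs M | P (mkseq z k) (z k).1].
Proof.
have := measurable_prefix k (fun h t => (P h t)%:R).
move/(_ measurableT [set 1%:E]) => /(_ (emeasurable_set1 _)).
rewrite setTI; congr measurable; apply/seteqP; split=> z /=.
  by case: (P _ _) => // -[/eqP]; rewrite eq_sym oner_eq0.
by move->.
Qed.

Variables (mu : probability (runs M) R) (sigma : sched M R) (s : state M).
Hypothesis mu_sigma : induces sigma s mu.

Lemma integral_prefix k (F : seq X -> state M -> R) :
    (forall h t, 0 <= F h t) ->
  (\int[mu]_z (F (mkseq z k) (z k).1)%:E = (prefix_exp sigma k [::] s F)%:E)%E.
Proof.
move=> F0; under eq_integral do rewrite prefix_indic_sum.
have mI (p : k.-tuple X * state M) :
    measurable_fun [set: runs M] (fun z : runs M => (\1_(cylinder p.1 p.2) z : R)%:E).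
  by apply/measurable_EFinP; apply: measurable_indic; exact: measurable_cylinder.
rewrite ge0_integral_sum //; last 2 first.
- by move=> p; apply: emeasurable_funM.
- by move=> p z _; rewrite mule_ge0 ?lee_fin.
rewrite -prefix_exp_sum pair_bigA /= -sumEFin; apply: eq_bigr => p _.
rewrite ge0_integralZl //; last first.
  by rewrite lee_fin.
rewrite integral_indic // ?setIT; last exact: measurable_cylinder.
apply: (etrans (congr1 (fun x => (F p.1 p.2)%:E * x)%E (mu_sigma p.1 p.2))).
by rewrite -EFinM mulrC.
Qed.

Lemma prob_prefix k (P : seq X -> state M -> bool) :
  mu [set z | P (mkseq z k) (z k).1] =
  (prefix_exp sigma k [::] s (fun h t => (P h t)%:R))%:E.
Proof.
rewrite -integral_prefix // -[X in mu X]setIT -integral_indic //.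
  by apply: eq_integral => z _; rewrite indicE mem_setE.
exact: measurable_prefix_set.
Qed.

Lemma wgt_upto_word (z : run M) k : wgt_upto z k = word_wgt (mkseq z k).
Proof.
rewrite /word_wgt /mkseq big_map /wgt_upto -(big_mkord xpredT (fun i => weight (z i).1 (z i).2)).
by rewrite /index_iota subn0.
Qed.

Lemma take_mkseq (z : run M) m k : (m <= k)%N -> take m (mkseq z k) = mkseq z m.
Proof. by move=> mk; rewrite /mkseq -map_take take_iota (minn_idPl mk). Qed.

Section Payoff.
Variables (goal : state M) (g : int -> R).
Hypothesis g_ge0 : forall x, 0 <= g x.
Hypothesis sigma_sched : is_scheduler sigma.

(** A version of [oplus] for a nonnegative function [g] of the weight, so that monotone convergence
    applies; it is used with the positive and the negative part of [y + b]. *)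
Definition payoff (z : runs M) : R :=
  match pselect (exists k, (z k).1 == goal) with
  | left reach_goal => g (wgt_upto z (ex_minn reach_goal))
  | right _ => 0
  end.

Lemma mkseq_goal (z : run M) k :
  rcons (unzip1 (mkseq z k)) (z k).1 = mkseq (fun i => (z i).1) k.+1.
Proof. by rewrite /mkseq -addn1 iotaD map_cat cats1 /unzip1 -map_comp. Qed.

Lemma prefix_payoffE (z : runs M) k : prefix_payoff goal g (mkseq z k) (z k).1 =
  if [exists j : 'I_k.+1, (z j).1 == goal] then payoff z else 0.
Proof.
have memE : (goal \in mkseq (fun i => (z i).1) k.+1) =
    [exists j : 'I_k.+1, (z j).1 == goal].
  apply/mapP/existsP => [[j]|[j /eqP <-]]; last first.
    by exists (j : nat); rewrite // mem_iota add0n ltn_ord.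
  by rewrite mem_iota add0n => /andP[_ jk] ->; exists (Ordinal jk).
rewrite /prefix_payoff mkseq_goal memE; case: ifP => // /[dup] ex /existsP[j0 zj0].
rewrite /payoff; case: pselect => [e|[]]; last by exists j0.
case: ex_minnP => m zm minm; have mk : (m <= k)%N.
  by rewrite (leq_trans (minm _ zj0)) // -ltnS.
rewrite wgt_upto_word -(take_mkseq z mk); congr (g (word_wgt (take _ _))).
have := memE; rewrite ex => gm; apply/eqP; rewrite eqn_leq; apply/andP; split.
  rewrite leqNgt; apply/negP => lt_m.
  have := before_find (a := pred1 goal) (z 0).1 lt_m.
  by rewrite nth_mkseq ?ltnS //= zm.
apply: minm; have i_lt : (index goal (mkseq (fun i => (z i).1) k.+1) < k.+1)%N.
  by rewrite -[X in (_ < X)%N](size_mkseq (fun i => (z i).1)) index_mem.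
by have := nth_index (z 0).1 gm; rewrite nth_mkseq // => ->.
Qed.

Lemma prefix_payoff_ge0 h t : 0 <= prefix_payoff goal g h t.
Proof. by rewrite /prefix_payoff; case: ifP. Qed.

Lemma payoff_ge0 z : 0 <= payoff z.
Proof. by rewrite /payoff; case: pselect. Qed.

Lemma prefix_payoff_homo (z : runs M) : {homo (fun k =>
  (prefix_payoff goal g (mkseq z k) (z k).1)%:E) : n m / (n <= m)%N >-> (n <= m)%E}.
Proof.
move=> n m nm; rewrite lee_fin !prefix_payoffE.
case: ifP => [/existsP[j zj]|_]; last by case: ifP => // _; exact: payoff_ge0.
by rewrite ifT //; apply/existsP; exists (widen_ord (nm : n < m.+1)%N j).
Qed.

Lemma prefix_payoff_lim (z : runs M) :
  limn (fun k => (prefix_payoff goal g (mkseq z k) (z k).1)%:E) = (payoff z)%:E.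
Proof.
apply/cvg_lim => //; have [[j zj]|nex] := pselect (exists k, (z k).1 == goal).
  apply: cvg_near_cst; exists j => // k /= jk.
  rewrite prefix_payoffE ifT //; apply/existsP.
  by exists (Ordinal (jk : j < k.+1)%N).
apply: cvg_near_cst; exists 0 => // k _ /=.
have z0 : payoff z = 0 by rewrite /payoff; case: pselect.
by rewrite prefix_payoffE z0; case: ifP.
Qed.

(** As [g] is nonnegative, the payoffs cut off at step [k] increase to [payoff], and monotone
    convergence moves the integral to finite horizons. *)
Lemma integral_payoff : (\int[mu]_z (payoff z)%:E =
  limn (fun k => (goal_value goal sigma k [::] s g)%:E))%E.
Proof.
under eq_integral do rewrite -prefix_payoff_lim.
rewrite monotone_convergence //; last 3 first.
- by move=> k; exact: measurable_prefix.
- by move=> k z _; rewrite lee_fin prefix_payoff_ge0.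
- by move=> z _; exact: prefix_payoff_homo.
congr (lim (_ @ \oo)%classic); apply/funext => k.
rewrite (integral_prefix k prefix_payoff_ge0) prefix_exp_payoff //.
by congr (goal_value _ _ _ _ _ _)%:E; apply/funext => x; rewrite /word_wgt big_nil add0r.
Qed.

Lemma goal_value_homo :
  nondecreasing_seq (fun k => (goal_value goal sigma k [::] s g)%:E).
Proof.
have E k : (goal_value goal sigma k [::] s g)%:E =
    (\int[mu]_z (prefix_payoff goal g (mkseq z k) (z k).1)%:E)%E.
  rewrite (integral_prefix k prefix_payoff_ge0) prefix_exp_payoff //.
  by congr (goal_value _ _ _ _ _ _)%:E; apply/funext => x; rewrite /word_wgt big_nil add0r.
move=> k l kl; rewrite !E; apply: ge0_le_integral => //.
- by move=> z _; rewrite lee_fin prefix_payoff_ge0.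
- exact: measurable_prefix.
- exact: measurable_prefix.
- by move=> z _; exact: prefix_payoff_homo.
Qed.

Lemma integral_payoff_ge k :
  ((goal_value goal sigma k [::] s g)%:E <= \int[mu]_z (payoff z)%:E)%E.
Proof.
rewrite integral_payoff (cvg_lim _ (ereal_nondecreasing_cvgn goal_value_homo)) //.
by apply: ereal_sup_ubound; exists k.
Qed.

Lemma integral_payoff_le c : (forall k, goal_value goal sigma k [::] s g <= c) ->
  (\int[mu]_z (payoff z)%:E <= c%:E)%E.
Proof.
move=> le_c; rewrite integral_payoff; apply: lime_le.
  exact: ereal_nondecreasing_is_cvgn goal_value_homo.
by apply: nearW => k; rewrite lee_fin.
Qed.

End Payoff.
End PrefixIntegral.

(** * Farkas' lemma and potentials *)

Section Farkas.
Variables (R : realFieldType) (J : finType).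
Implicit Types (v c : J -> R).

Definition dot c v : R := \sum_j c j * v j.

Lemma dot_subZl c (k : R) c' v :
  dot (fun j => c j - k * c' j) v = dot c v - k * dot c' v.
Proof.
rewrite /dot mulr_sumr -sumrB; apply: eq_bigr => j _.
by rewrite mulrBl mulrA.
Qed.

Lemma dot_subZr c v (k : R) v' :
  dot c (fun j => v j - k * v' j) = dot c v - k * dot c v'.
Proof.
rewrite /dot mulr_sumr -sumrB; apply: eq_bigr => j _.
by rewrite mulrBr mulrCA.
Qed.

(* Bartl's induction on the number of inequalities. *)
Lemma farkas (I : eqType) (s : seq I) (a : I -> J -> R) c : uniq s ->
    (forall v, (forall i, i \in s -> dot (a i) v <= 0) -> dot c v <= 0) ->
  exists2 x : I -> R, (forall i, 0 <= x i) &
    forall j, c j = \sum_(i <- s) x i * a i j.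
Proof.
elim: s a c => [|i0 s IH] a c.
  move=> _ /(_ c) cc; exists (fun=> 0) => // j; rewrite big_nil.
  have cc0 : \sum_j c j * c j = 0.
    apply/eqP; rewrite eq_le cc //= sumr_ge0 // => k _.
    by rewrite -expr2 sqr_ge0.
  have : c j * c j = 0 by apply: (psumr_eq0P _ cc0) => // k _; rewrite -expr2 sqr_ge0.
  by move/eqP; rewrite -expr2 sqrf_eq0 => /eqP.
rewrite cons_uniq => /andP[i0s us] imp.
have [all_v|] := pselect (forall v, (forall i, i \in s -> dot (a i) v <= 0) -> dot c v <= 0).
  have [x x0 xE] := IH a c us all_v; exists (fun i => if i == i0 then 0 else x i) => [i|j].
    by case: ifP.
  rewrite big_cons eqxx mul0r add0r xE !big_seq; apply: eq_bigr => i i_s.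
  by case: eqP => // e; rewrite -e i_s in i0s.
(* The inequalities in [s] hold at [w] while that of [c] fails, so [w] must violate the one of
   [i0]. *)
move=> /existsNP[w /not_implyP[ws /negP]]; rewrite -ltNge => cw.
have aw : 0 < dot (a i0) w.
  rewrite ltNge; apply/negP => aw; move: cw; rewrite ltNge => /negP; apply; apply: imp => i.
  by rewrite inE => /orP[/eqP ->|/ws].
set al := dot (a i0) w in aw; have al0 : al != 0 by rewrite gt_eqF.
pose a' i j := a i j - dot (a i) w / al * a i0 j.
pose c' j := c j - dot c w / al * a i0 j.
have [|x x0 xE] := IH a' c' us.
  move=> v a'v; pose v' j := v j - dot (a i0) v / al * w j.
  have E b : dot (fun j => b j - dot b w / al * a i0 j) v = dot b v'.
    by rewrite dot_subZl dot_subZr; field.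
  rewrite E; apply: imp => i; rewrite inE => /orP[/eqP ->|i_s].
    by rewrite dot_subZr -/al divfK // subrr.
  by rewrite -E; exact: a'v.
(* The coefficient of [a i0] that results from expanding [a'] and [c'] in the identity of the
   induction hypothesis; it is nonnegative because [dot c w > 0] and [dot (a i) w <= 0] on [s]. *)
pose l := (dot c w - \sum_(i <- s) x i * dot (a i) w) / al.
have l0 : 0 <= l.
  rewrite divr_ge0 ?(ltW aw) // subr_ge0 (le_trans _ (ltW cw)) //.
  rewrite big_seq; apply: sumr_le0 => i i_s.
  by rewrite mulr_ge0_le0 ?ws.
exists (fun i => if i == i0 then l else x i) => [i|j]; first by case: ifP.
rewrite big_cons eqxx (eq_big_seq (fun i => x i * a i j)); last first.
  by move=> i i_s; case: eqP => // e; rewrite -e i_s in i0s.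
have := xE j; rewrite /c' => /eqP; rewrite subr_eq => /eqP ->.
rewrite /l mulrBl mulrBl addrAC -addrA [RHS]addrC; congr (_ + _).
rewrite mulr_suml mulr_suml -sumrB; apply: eq_bigr => i _.
by rewrite /a' mulrBr !mulrA.
Qed.
End Farkas.

Section Potentials.
Variables (R : realType) (M : mdp).
Implicit Types (s t : state M) (p q : state M * act M) (f u : state M -> R).
Implicit Types (x w : state M * act M -> R) (Q : {set state M * act M}).

Definition drift p f : R := \sum_t prob R p.1 p.2 t * f t - f p.1.

Lemma driftDZ p f (k : R) f' :
  drift p (fun t => f t + k * f' t) = drift p f + k * drift p f'.
Proof.
rewrite /drift mulrBr mulr_sumr opprD addrACA; congr (_ + _).
by rewrite -big_split; apply: eq_bigr => t _ /=; rewrite mulrDr mulrCA.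
Qed.

Lemma driftZ p (k : R) f : drift p (fun t => k * f t) = k * drift p f.
Proof.
rewrite /drift mulrBr mulr_sumr; congr (_ - _).
by apply: eq_bigr => t _; rewrite mulrCA.
Qed.

Lemma driftE p f : p.2 \in enabled p.1 ->
  drift p f = \sum_t prob R p.1 p.2 t * (f t - f p.1).
Proof.
move=> /(prob_sum R) p1; rewrite /drift -[X in _ - X]mul1r -p1 mulr_suml -sumrB.
by apply: eq_bigr => t _; rewrite mulrBr.
Qed.

(** Conservation of flow in dual form: instead of balancing inflow and outflow of each state, it is
    tested against every function on states. *)
Definition stationary x := (forall p, 0 <= x p) /\ forall f, \sum_p x p * drift p f = 0.

(** The coefficients of [w p + drift p u <= 0], homogenised: the coordinate [None] multiplies the
    constant [w p]. *)
Definition row w p (j : option (state M)) : R :=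
  if j is Some t then prob R p.1 p.2 t - (t == p.1)%:R else w p.

Lemma big_option (F : option (state M) -> R) : \sum_j F j = F None + \sum_t F (Some t).
Proof.
rewrite (bigD1 None) //=; congr (_ + _).
rewrite (reindex_omap Some id) => [|[]//]; by apply: eq_bigl => t; rewrite eqxx.
Qed.

Lemma dot_row w p v :
  dot (row w p) v = w p * v None + drift p (fun t => v (Some t)).
Proof.
rewrite /dot big_option; congr (_ + _); rewrite /row /drift.
rewrite (eq_bigr (fun t => prob R p.1 p.2 t * v (Some t) - (t == p.1)%:R * v (Some t))).
  rewrite sumrB; congr (_ - _); rewrite (bigD1 p.1) //= eqxx mul1r big1 ?addr0 // => t /negbTE ->.
  by rewrite mul0r.
by move=> t _; rewrite mulrBl.
Qed.

Lemma stationary_rows x w : (forall p, 0 <= x p) ->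
  (forall t, \sum_p x p * row w p (Some t) = 0) -> stationary x.
Proof.
move=> x0 xrow; split=> // f.
transitivity (\sum_t (\sum_p x p * row w p (Some t)) * f t); last first.
  by rewrite big1 // => t _; rewrite xrow mul0r.
under [RHS]eq_bigr do rewrite mulr_suml.
rewrite exchange_big; apply: eq_bigr => p _ /=.
have := dot_row w p (fun j => if j is Some t then f t else 0).
rewrite mulr0 add0r => <-; rewrite /dot big_option mulr0 add0r mulr_sumr.
by apply: eq_bigr => t _; rewrite mulrA.
Qed.

Lemma farkas_rows Q w c :
    (forall v, (forall p, p \in Q -> dot (row w p) v <= 0) -> dot c v <= 0) ->
  exists x, [/\ forall p, 0 <= x p, forall p, p \notin Q -> x p = 0 &
    forall j, c j = \sum_p x p * row w p j].
Proof.
move=> imp; have [|x x0 xE] := @farkas R _ _ (enum Q) (row w) c (enum_uniq _).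
  by move=> v hv; apply: imp => p pQ; apply: hv; rewrite mem_enum.
exists (fun p => if p \in Q then x p else 0); split=> [p|p|j].
- by case: ifP.
- by move/negbTE ->.
- rewrite xE big_enum big_mkcond; apply: eq_bigr => p _.
  by case: ifP; rewrite ?mul0r.
Qed.

(** Farkas' lemma for the functional [v None]. A solution of the homogeneous system with
    [v None > 0] rescales to a potential; otherwise the multipliers form a flow of total weight
    1. *)
Lemma potential_or_stationary Q w :
  (exists u, forall p, p \in Q -> w p + drift p u <= 0) \/
  (exists x, [/\ stationary x, forall p, p \notin Q -> x p = 0 & 0 < \sum_p x p * w p]).
Proof.
have [|nex] := pselect (exists u, forall p, p \in Q -> w p + drift p u <= 0); first by left.
right; pose c (j : option (state M)) : R := (j == None)%:R.
have [|x [x0 xQ xE]] := @farkas_rows Q w c.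
  move=> v vQ; have -> : dot c v = v None.
    by rewrite /dot big_option /c eqxx mul1r big1 ?addr0 // => t _; rewrite mul0r.
  rewrite leNgt; apply/negP => v0; apply: nex.
  exists (fun t => (v None)^-1 * v (Some t)) => p pQ; rewrite driftZ.
  rewrite -(pmulr_rle0 _ v0) mulrDr mulVKf ?gt_eqF // mulrC -dot_row.
  exact: vQ.
exists x; split=> //; first by apply: (@stationary_rows _ w) => // t; rewrite -xE.
by have := xE None; rewrite /c /= => <-.
Qed.

(** Complementary slackness. If [p0] can never be strict, [- row w p0] is a nonnegative combination
    of rows; adding [p0] itself with coefficient 1 gives a flow through [p0]. *)
Lemma strict_or_stationary Q w p0 u0 :
    (forall p, p \in Q -> w p + drift p u0 <= 0) -> p0 \in Q ->
  (exists2 u, (forall p, p \in Q -> w p + drift p u <= 0) & w p0 + drift p0 u < 0) \/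
  (exists x, [/\ stationary x, forall p, p \notin Q -> x p = 0, 0 < x p0 &
     \sum_p x p * w p = 0]).
Proof.
move=> feas p0Q; have [|nex] := pselect (exists2 u,
  (forall p, p \in Q -> w p + drift p u <= 0) & w p0 + drift p0 u < 0); first by left.
right; have [|x [x0 xQ xE]] := @farkas_rows Q w (fun j => - row w p0 j).
  move=> v vQ; rewrite (_ : dot _ v = - dot (row w p0) v); last first.
    by rewrite /dot -sumrN; apply: eq_bigr => j _; rewrite mulNr.
  rewrite oppr_le0 leNgt; apply/negP => v0; apply: nex.
  (* [v None] may be nonpositive; adding [K] times the known potential [u0], whose constant
     coordinate is 1, makes that coordinate the positive number [r], by which one can divide. *)
  pose K := `|v None| + 1; pose r := v None + K.
  have K0 : 0 < K by rewrite ltr_wpDl.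
  have r0 : 0 < r by have := ler_norm (- v None); rewrite normrN /r /K; lra.
  have E p : r * (w p + drift p (fun t => r^-1 * (v (Some t) + K * u0 t))) =
      dot (row w p) v + K * (w p + drift p u0).
    rewrite driftZ driftDZ dot_row mulrDr mulVKf ?gt_eqF // /r; ring.
  exists (fun t => r^-1 * (v (Some t) + K * u0 t)) => [p pQ|].
    by rewrite -(pmulr_rle0 _ r0) E ler_wnDr ?vQ // mulr_ge0_le0 ?(ltW K0) ?feas.
  by rewrite -(pmulr_rlt0 _ r0) E ltr_wnDr // mulr_ge0_le0 ?(ltW K0) ?feas.
have S j : \sum_p (x p + (p == p0)%:R) * row w p j = 0.
  under eq_bigr do rewrite mulrDl; rewrite big_split /= -xE.
  rewrite (bigD1 p0) //= eqxx mul1r big1 ?addr0 ?addNr // => p /negbTE ->.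
  by rewrite mul0r.
exists (fun p => x p + (p == p0)%:R); split.
- by apply: (@stationary_rows _ w) => [p|t]; [rewrite addr_ge0 | exact: S].
- by move=> p pQ; rewrite xQ // add0r; case: eqP => // e; rewrite e p0Q in pQ.
- by rewrite eqxx ltr_wpDl.
- exact: (S None).
Qed.

(** Averaging two potentials keeps the inequalities and is strict wherever one of them is, so a
    single potential can be strict at all pairs that admit strictness. *)
Lemma strict_potential Q w u0 :
    (forall p, p \in Q -> w p + drift p u0 <= 0) ->
  exists2 u, (forall p, p \in Q -> w p + drift p u <= 0) &
    forall p, p \in Q ->
      (exists2 u', (forall q, q \in Q -> w q + drift q u' <= 0) & w p + drift p u' < 0) ->
    w p + drift p u < 0.
Proof.
move=> feas; suff [u uQ ul] : exists2 u, (forall p, p \in Q -> w p + drift p u <= 0) &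
    forall p, p \in enum Q ->
      (exists2 u', (forall q, q \in Q -> w q + drift q u' <= 0) & w p + drift p u' < 0) ->
    w p + drift p u < 0.
  by exists u => // p pQ; apply: ul; rewrite mem_enum.
have : {subset enum Q <= Q} by move=> p; rewrite mem_enum.
elim: (enum Q) => [_|p0 l IH lQ]; first by exists u0.
have [|u uQ ul] := IH; first by move=> p pl; apply: lQ; rewrite inE pl orbT.
have [[u' u'Q u'p]|nex] := pselect (exists2 u',
    (forall q, q \in Q -> w q + drift q u' <= 0) & w p0 + drift p0 u' < 0); last first.
  by exists u => // p; rewrite inE => /orP[/eqP -> /nex|/ul].
have E p : w p + drift p (fun t => 2^-1 * (u t + 1 * u' t)) =
    2^-1 * ((w p + drift p u) + (w p + drift p u')).
  by rewrite driftZ driftDZ; field.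
have h0 : 0 < 2^-1 :> R by rewrite invr_gt0 ltr0n.
exists (fun t => 2^-1 * (u t + 1 * u' t)) => [p pQ|p pl ex].
  by rewrite E pmulr_rle0 // ler_wnDr ?uQ ?u'Q.
rewrite E pmulr_rlt0 //; move: pl ex; rewrite inE => /orP[/eqP -> _|pl ex].
  by rewrite ltr_wnDl // uQ // lQ // mem_head.
by rewrite ltr_wnDr ?ul // u'Q // lQ // inE pl orbT.
Qed.
End Potentials.

(** * Divergence of uniform schedulers *)

Section Hitting.
Variables (R : realType) (M : mdp).
Implicit Types (s t : state M) (a : act M) (past h : seq (state M * act M)).
Implicit Types (sigma : sched M R) (m : int).

(** Here [m] is the climb that remains; a level once reached counts even if the weight falls
    again. *)
Fixpoint reached m h : bool :=
  (m <= 0) || (if h is x :: h' then reached (m - weight x.1 x.2) h' else false).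

Lemma reached_cat m h h' : reached m h -> reached m (h ++ h').
Proof.
elim: h m => [|x h IH] m /=; first by rewrite orbF; case: h' => [|? ?] /= ->.
by case/orP => [->//|/IH ->]; rewrite orbT.
Qed.

Lemma reached_rcons m h s a :
  reached m (rcons h (s, a)) = reached m h || (m <= word_wgt (rcons h (s, a))).
Proof.
elim: h m => [|[s' a'] h IH] m /=.
  rewrite !orbF word_wgt_cons /word_wgt big_nil addr0; congr orb.
  by rewrite subr_le0.
by rewrite IH word_wgt_cons lerBlDl orbA.
Qed.

Lemma reached_nil m : reached m [::] = (m <= word_wgt ([::] : seq (state M * act M))).
Proof. by rewrite /= orbF /word_wgt big_nil. Qed.

Lemma wgt_reaches_bigcup n :
  wgt_reaches n = \bigcup_k [set z : runs M | reached n%:Z (mkseq z k)].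
Proof.
have E (z : runs M) k : reached n%:Z (mkseq z k) <->
    exists2 j, (j <= k)%N & n%:Z <= wgt_upto z j.
  elim: k => [|k IH].
    rewrite reached_nil -[_ [::]]/(word_wgt (mkseq z 0)) -wgt_upto_word.
    by split=> [|[j]]; [exists 0 | rewrite leqn0 => /eqP ->].
  have -> : mkseq z k.+1 = rcons (mkseq z k) ((z k).1, (z k).2).
    by rewrite -surjective_pairing /mkseq -addn1 iotaD map_cat cats1.
  rewrite reached_rcons (_ : rcons _ _ = mkseq z k.+1); last first.
    by rewrite -surjective_pairing /mkseq -addn1 iotaD map_cat cats1.
  rewrite -wgt_upto_word; split=> [/orP[/IH[j jk nj]|]|[j]].
  - by exists j => //; exact: leqW.
  - by exists k.+1.
  - rewrite leq_eqVlt => /orP[/eqP -> ->|jk nj]; first by rewrite orbT.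
    by apply/orP; left; apply/IH; exists j.
apply/seteqP; split=> [z [k nk]|z [k _ /E[j _ nj]]]; last by exists j.
by exists k => //; apply/E; exists k.
Qed.

(** The probability of gaining weight [m] at some moment within the next [k] steps. *)
Fixpoint hit sigma k past s m : R :=
  if m <= 0 then 1 else
  if k is k'.+1 then
    step (sigma past s) s (fun a t => hit sigma k' (rcons past (s, a)) t (m - weight s a))
  else 0.

Lemma hit_le0 sigma k past s m : m <= 0 -> hit sigma k past s m = 1.
Proof. by case: k => [|k] /= ->. Qed.

Lemma hitS sigma k past s m : 0 < m -> hit sigma k.+1 past s m =
  step (sigma past s) s (fun a t => hit sigma k (rcons past (s, a)) t (m - weight s a)).
Proof. by move=> /= /lt_geF ->. Qed.

Section Schedule.
Variables (E : {set state M}) (A : state M -> {set act M}) (sigma : sched M R).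
Hypotheses (EA : sub_mdp E A) (sigma_sched : is_scheduler_in E A sigma).

(** [hit] sees only the present weight. The second hypothesis excludes pasts that have reached the
    level and fallen below it again, where the two sides would differ. *)
Lemma prefix_exp_reached k past s m :
    is_path_in E A past s -> reached m past = (m <= word_wgt past) ->
  prefix_exp sigma k past s (fun h _ => (reached m h)%:R) =
  hit sigma k past s (m - word_wgt past).
Proof.
elim: k past s => [|k IH] past s ps ract /=; rewrite subr_le0 -ract; case: ifP => r //.
  rewrite -/(prefix_exp sigma k.+1 past s (fun h _ => (reached m h)%:R)).
  by apply: (prefix_exp_cst EA _ sigma_sched ps) => h t _; rewrite reached_cat.
apply: (eq_step (sigma_sched ps)) => a t aA pt.
rewrite IH ?reached_rcons ?r //; last exact: is_path_in_extend.
by rewrite word_wgt_rcons opprD addrA.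
Qed.

Lemma hit_ge0 k past s m : is_path_in E A past s -> 0 <= hit sigma k past s m.
Proof.
elim: k past s m => [|k IH] past s m ps /=; case: ifP => // _.
apply: (step_lb (sigma_sched ps)); first exact: EA.1 (is_path_in_last ps).
by move=> a t aA pt; apply: IH; exact: is_path_in_extend.
Qed.

Lemma hit_le1 k past s m : is_path_in E A past s -> hit sigma k past s m <= 1.
Proof.
elim: k past s m => [|k IH] past s m ps /=; case: ifP => // _.
apply: (step_ub (sigma_sched ps)); first exact: EA.1 (is_path_in_last ps).
by move=> a t aA pt; apply: IH; exact: is_path_in_extend.
Qed.

Lemma hit_leS k past s m : is_path_in E A past s ->
  hit sigma k past s m <= hit sigma k.+1 past s m.
Proof.
elim: k past s m => [|k IH] past s m ps; (have [m0|m0] := leP m 0;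
  first by rewrite !hit_le0).
  have -> : hit sigma 0 past s m = 0 by rewrite /= lt_geF.
  exact: hit_ge0.
rewrite [leLHS]hitS // [leRHS]hitS //; apply: (step_le (sigma_sched ps)) => a t aA pt.
by apply: IH; exact: is_path_in_extend.
Qed.

Lemma hit_homo past s m : is_path_in E A past s ->
  nondecreasing_seq (fun k => hit sigma k past s m).
Proof. by move=> ps; apply/nondecreasing_seqP => k; exact: hit_leS. Qed.

Variables (mu : probability (runs M) R) (s : state M).
Hypotheses (sE : s \in E) (mu_sigma : induces sigma s mu).

Lemma prob_reached n k :
  mu [set z | reached n%:Z (mkseq z k)] = (hit sigma k [::] s n%:Z)%:E.
Proof.
rewrite (prob_prefix mu_sigma k (fun h _ => reached n%:Z h)) prefix_exp_reached.
- by rewrite /word_wgt big_nil subr0.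
- by rewrite /is_path_in /= sE.
- exact: reached_nil.
Qed.

Lemma measurable_reached n k : measurable [set z : runs M | reached n%:Z (mkseq z k)].
Proof. exact: (measurable_prefix_set R k (fun h _ => reached n%:Z h)). Qed.

Lemma measurable_wgt_reaches n : measurable (wgt_reaches n : set (runs M)).
Proof.
by rewrite wgt_reaches_bigcup; apply: bigcup_measurable => k _; exact: measurable_reached.
Qed.

Lemma hit_le_reaches n k : ((hit sigma k [::] s n%:Z)%:E <= mu (wgt_reaches n))%E.
Proof.
rewrite -prob_reached le_measure ?inE //.
- exact: measurable_reached.
- exact: measurable_wgt_reaches.
by rewrite wgt_reaches_bigcup => z zk; exists k.
Qed.

Lemma reaches_le n (c : R) : (forall k, hit sigma k [::] s n%:Z <= c) ->
  (mu (wgt_reaches n) <= c%:E)%E.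
Proof.
move=> le_c; rewrite wgt_reaches_bigcup.
have ndF : {homo (fun k => [set z : runs M | reached n%:Z (mkseq z k)]) :
    k l / (k <= l)%N >-> (k <= l)%O}.
  move=> k l kl; apply/subsetPset => z /=; rewrite -(subnKC kl) /mkseq iotaD map_cat.
  exact: reached_cat.
have := nondecreasing_cvg_mu (mu := mu) (measurable_reached n)
  (bigcup_measurable (fun k _ => measurable_reached n k)) ndF.
move=> cv; rewrite -(cvg_lim _ cv) //; apply: lime_le; first by apply/cvg_ex; eexists; exact: cv.
by apply: nearW => k; rewrite /= prob_reached lee_fin.
Qed.
End Schedule.
End Hitting.

(** * The uniform memoryless scheduler and the maximum principle *)

Section UniformScheduler.
Variables (R : realType) (M : mdp).
Variables (E : {set state M}) (A : state M -> {set act M}) (u : state M -> R).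
Hypothesis EA : end_component E A.
Hypothesis drift_ge0 : forall s a, s \in E -> a \in A s ->
  0 <= (weight s a)%:~R + drift (s, a) u.
Hypothesis climb : forall s, s \in E -> forall L : int,
  exists h t, [/\ is_path_in E A h t, first_state h t = s & L <= word_wgt h].
Implicit Types (s t : state M) (a : act M) (past h : seq (state M * act M)).
Implicit Types (m : int).

(** Outside [E] all enabled actions are allowed, so that the scheduler is defined on the whole MDP
    and induces a measure. *)
Definition uniform_acts s : {set act M} := if s \in E then A s else enabled s.

Definition uniform_sched : sched M R :=
  fun _ s a => (a \in uniform_acts s)%:R / #|uniform_acts s|%:R.

Local Notation up s := (uniform_sched [::] s).

Let uniform_acts_E s : s \in E -> uniform_acts s = A s.
Proof. by rewrite /uniform_acts => ->. Qed.

Lemma uniform_acts_sub : sub_mdp [set: state M]%SET uniform_acts.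
Proof.
split=> [s _|*]; last by rewrite inE.
rewrite /uniform_acts; case: ifP => // sE.
by have [_ /(_ s sE)[]] := EA.
Qed.

Let sub_EA : sub_mdp E A := end_component_sub_mdp EA.

Lemma uniform_acts_gt0 s : (0 < #|uniform_acts s|)%N.
Proof.
rewrite card_gt0 /uniform_acts; case: ifP => [sE|_].
  by have [_ /(_ s sE)[]] := EA.
have [a a_s] := enabled_ex s; apply/finset.set0Pn; exists a.
by rewrite enabledE.
Qed.

Lemma uniform_gt0 h s a : a \in uniform_acts s -> 0 < uniform_sched h s a.
Proof. by move=> a_s; rewrite /uniform_sched a_s divr_gt0 ?ltr0n ?uniform_acts_gt0. Qed.

Lemma uniform_distr h s : distr_on (uniform_acts s) (uniform_sched h s).
Proof.
split=> [a||a]; rewrite /uniform_sched.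
- by rewrite divr_ge0.
- rewrite -mulr_suml -natr_sum -big_mkcond /= sum1_card divff // pnatr_eq0.
  by rewrite -lt0n uniform_acts_gt0.
- by move/negbTE ->; rewrite mul0r.
Qed.

Lemma uniform_sched_all : is_scheduler_in [set: state M]%SET uniform_acts uniform_sched.
Proof. by move=> h t _; exact: uniform_distr. Qed.

Lemma uniform_is_scheduler : is_scheduler uniform_sched.
Proof.
move=> h t _; have [p0 p1 pout] := uniform_distr h t; split=> // a a_t.
apply: pout; apply: contra a_t; apply: fintype.subsetP.
by apply: uniform_acts_sub.1; rewrite inE.
Qed.

Lemma uniform_is_scheduler_in : is_scheduler_in E A uniform_sched.
Proof.
move=> h t /is_path_in_last tE; have := uniform_distr h t.
by rewrite uniform_acts_E.
Qed.

Lemma uniform_hit_past k past s m :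
  hit uniform_sched k past s m = hit uniform_sched k [::] s m.
Proof.
suff H past' : hit uniform_sched k past s m = hit uniform_sched k past' s m by [].
elim: k past past' s m => [//|k IH] past past' s m /=; case: ifP => // _.
apply: (eq_step (uniform_distr past s)) => a t _ _; exact: IH.
Qed.

Lemma cvg_step p s (X : nat -> act M -> state M -> R) Y :
    (forall a t, X k a t @[k --> \oo] --> Y a t) ->
  step p s (X k) @[k --> \oo] --> step p s Y.
Proof.
move=> XY; apply: cvg_big => [|a _]; first exact: add_continuous.
apply: cvgMl_tmp; apply: cvg_big => [|t _]; first exact: add_continuous.
by apply: cvgMl_tmp; exact: XY.
Qed.

Let path_nil s : is_path_in [set: state M]%SET uniform_acts [::] s.
Proof. by rewrite /is_path_in /= inE. Qed.

Definition hit_lim s m : R := limn (fun k => hit uniform_sched k [::] s m).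

Lemma hit_cvg s m : hit uniform_sched k [::] s m @[k --> \oo] --> hit_lim s m.
Proof.
apply: nondecreasing_is_cvgn.
  exact: (hit_homo uniform_acts_sub uniform_sched_all).
exists 1 => _ [k _ <-].
exact: (hit_le1 uniform_acts_sub uniform_sched_all).
Qed.

Lemma hit_lim_step s m : 0 < m ->
  hit_lim s m = step (up s) s (fun a t => hit_lim t (m - weight s a)).
Proof.
move=> m0; apply: (@cvg_unique _ _ (hit uniform_sched k.+1 [::] s m @[k --> \oo])) => //.
  by have := @hit_cvg s m; rewrite -cvg_shiftS.
have -> : (fun k => hit uniform_sched k.+1 [::] s m) =
    (fun k => step (up s) s (fun a t => hit uniform_sched k [::] t (m - weight s a))).
  apply/funext => k; rewrite hitS //; apply: (eq_step (uniform_distr _ _)) => a t _ _.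
  exact: uniform_hit_past.
by apply: cvg_step => a t; exact: hit_cvg.
Qed.

Lemma hit_lim_le1 s m : hit_lim s m <= 1.
Proof.
apply: limr_le; first by apply/cvg_ex; eexists; exact: hit_cvg.
by apply: nearW => k; exact: (hit_le1 uniform_acts_sub uniform_sched_all).
Qed.

Lemma hit_lim_ge0 s m : 0 <= hit_lim s m.
Proof.
apply: limr_ge; first by apply/cvg_ex; eexists; exact: hit_cvg.
by apply: nearW => k; exact: (hit_ge0 uniform_acts_sub uniform_sched_all).
Qed.

Lemma hit_lim_le0 s m : m <= 0 -> hit_lim s m = 1.
Proof.
move=> m0; rewrite /hit_lim; under eq_fun do rewrite hit_le0 //.
exact: lim_cst.
Qed.

(** The maximum principle for one step: a successor with [X a t < c] would pull the average below
    [c] by at least [p a * prob R s a t * (c - X a t)]. *)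
Lemma step_max (B : {set act M}) (p : act M -> R) s X c a t : distr_on B p -> B \subset enabled s ->
    (forall a t, a \in B -> 0 < trans s a t -> X a t <= c) -> c <= step p s X ->
  0 < p a -> 0 < trans s a t -> X a t = c.
Proof.
move=> pB Bs Xc cX pa pt; have aB : a \in B.
  by have [_ _ pout] := pB; apply: contraLR pa => /pout ->; rewrite ltxx.
pose Y b r : R := if (b == a) && (r == t) then X a t - c else 0.
have XY : step p s X <= step p s (fun b r => c + Y b r).
  apply: (step_le pB) => b r bB br; rewrite /Y; case: andP => [[/eqP -> /eqP ->]|_].
    by rewrite addrC subrK.
  by rewrite addr0 Xc.
have := le_trans cX XY; rewrite stepD (step_cst _ pB Bs) lerDl.
rewrite /step (bigD1 a) //= [X in _ + X]big1 ?addr0 => [|b /negbTE ba]; last first.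
  by rewrite big1 ?mulr0 // => r _; rewrite /Y ba mulr0.
rewrite (bigD1 t) //= [X in _ + X]big1 ?addr0 => [|r /negbTE rt]; last first.
  by rewrite /Y rt andbF mulr0.
rewrite /Y !eqxx pmulr_rge0 // pmulr_rge0 ?prob_gt0 // subr_ge0 => cXat.
by apply/eqP; rewrite eq_le cXat Xc.
Qed.

(** [W] bounds the overshoot when the remaining climb drops to 0 or below; [K] also dominates [u],
    so that [climb_potential] is still nonnegative at that moment. *)
Let W : R := \sum_(s : state M) \sum_a `|(weight s a)%:~R|.
Let K : R := \sum_s `|u s| + W.

Let weight_le s a : `|(weight s a)%:~R| <= W.
Proof.
rewrite /W (bigD1 s) //= (bigD1 a) //= -addrA lerDl addr_ge0 // sumr_ge0 // => s' _.
exact: sumr_ge0.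
Qed.

(* A supermartingale under [uniform_sched] that is nonnegative up to the first
   time at which the remaining climb [m] is at most 0. *)
Definition climb_potential s m : R := K + m%:~R - u s.

Lemma climb_potential_ge s m : m%:~R + W <= climb_potential s m.
Proof.
have us : u s <= \sum_s `|u s|.
  rewrite (bigD1 s) //= (le_trans (ler_norm _)) // lerDl; exact: sumr_ge0.
by rewrite /climb_potential /K; lra.
Qed.

Lemma climb_potential_step s m : s \in E ->
  step (up s) s (fun a t => climb_potential t (m - weight s a)) <= climb_potential s m.
Proof.
move=> sE; have [p0 p1 pout] := uniform_distr [::] s.
rewrite -[leRHS]mul1r -p1 mulr_suml; apply: ler_sum => a _.
have [aA|/pout ->] := boolP (a \in uniform_acts s); last by rewrite !mul0r.
rewrite ler_wpM2l //.
have a_s : a \in enabled s.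
  by apply: (fintype.subsetP (uniform_acts_sub.1 s _)) => //; rewrite inE.
rewrite uniform_acts_E // in aA; have := drift_ge0 sE aA.
rewrite /drift /=; set S := \sum_t _ => dr.
rewrite (_ : \sum_t _ = K + (m - weight s a)%:~R - S).
  by rewrite /climb_potential intrB; lra.
rewrite /climb_potential; under eq_bigr do rewrite mulrBr.
by rewrite sumrB -mulr_suml prob_sum // mul1r.
Qed.

(** The difference [f] of the two sides is at most its one-step average while the climb is positive,
    and it is nonpositive once the climb is done or exceeds [L]. A positive value would thus give a
    positive maximum, which spreads along all paths in [E] since every action of [A] has positive
    probability; but by [climb] some path ends the climb. *)
Lemma hit_lim_ge L s m : 0 < L -> s \in E -> 0 < m ->
  1 - hit_lim s m <= climb_potential s m / L.
Proof.
move=> L0 sE m0; rewrite leNgt; apply/negP => lt_sm.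
pose f s m : R := 1 - hit_lim s m - climb_potential s m / L.
have W0 : 0 <= W by apply: sumr_ge0 => s' _; exact: sumr_ge0.
have f_le0 t m' : - W <= m'%:~R -> m' <= 0 -> f t m' <= 0.
  move=> Wm m'0; rewrite /f hit_lim_le0 // subrr sub0r oppr_le0 divr_ge0 ?(ltW L0) //.
  by apply: le_trans (climb_potential_ge t m'); lra.
have f_far t m' : L <= m'%:~R -> f t m' <= 0.
  move=> Lm; have : 1 <= climb_potential t m' / L.
    by rewrite ler_pdivlMr // mul1r (le_trans _ (climb_potential_ge t m')) //; lra.
  by have := hit_lim_ge0 t m'; rewrite /f; lra.
pose N := Num.bound L.
have LN : L < N%:R by apply: archi_boundP; exact: ltW.
have far_N m' : N%:Z <= m' -> L <= m'%:~R.
  by move=> Nm; rewrite (le_trans (ltW LN)) // -[N%:R]/(N%:Z%:~R) ler_int.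
have mN : (`|m| < N)%N.
  rewrite ltnNge; apply/negP => Nm; move: lt_sm; rewrite -subr_gt0 -/(f s m).
  by rewrite ltNge f_far // far_N; lia.
pose F (x : state M * 'I_N) : R := f x.1 (x.2 : nat)%:Z.
(* A maximum over finitely many points; by [f_le0] and [f_far] it bounds [f] on [E] for every climb
   above [- W]. *)
have [[s1 i1] /= s1E maxF] := @arg_maxP _ _ _ (s, Ordinal mN) (fun x => x.1 \in E) F sE.
have eta_gt0 : 0 < F (s1, i1).
  apply: lt_le_trans (maxF (s, Ordinal mN) sE).
  by rewrite /F /= gez0_abs ?(ltW m0) // /f subr_gt0.
have f_max t m' : t \in E -> - W <= m'%:~R -> f t m' <= F (s1, i1).
  move=> tE Wm; have [m'0|m'0] := leP m' 0; first by rewrite (le_trans (f_le0 _ _ Wm m'0)) ?ltW.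
  have [Nm|mN'] := leP N%:Z m'; first by rewrite (le_trans (f_far _ _ (far_N _ Nm))) ?ltW.
  have lt : (`|m'| < N)%N by lia.
  by have := maxF (t, Ordinal lt) tE; rewrite /F /= gez0_abs ?(ltW m'0).
have f_pos t m' : - W <= m'%:~R -> f t m' = F (s1, i1) -> 0 < m'.
  move=> Wm e; rewrite ltNge; apply/negP => /(f_le0 t _ Wm).
  by rewrite e leNgt eta_gt0.
have f_step t m' : t \in E -> 0 < m' ->
    f t m' <= step (up t) t (fun a r => f r (m' - weight t a)).
  move=> tE m'0; rewrite /f.
  have -> : step (up t) t (fun a r => 1 - hit_lim r (m' - weight t a) -
        climb_potential r (m' - weight t a) / L) =
      step (up t) t (fun a r => (1 + (-1) * hit_lim r (m' - weight t a)) +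
        (- L^-1) * climb_potential r (m' - weight t a)).
    by apply: (eq_step (uniform_distr [::] t)) => a r _ _; rewrite mulN1r mulNr mulrC.
  rewrite !stepD !stepZ (step_cst _ (uniform_distr [::] t)); last first.
    by apply: uniform_acts_sub.1; rewrite inE.
  rewrite -hit_lim_step // mulN1r mulNr lerD2l lerN2 mulrC ler_wpM2r //.
    by rewrite invr_ge0 ltW.
  exact: climb_potential_step.
have stay h t m' : is_path_in E A h t -> 0 < m' ->
    f (first_state h t) m' = F (s1, i1) -> 0 < m' - word_wgt h.
  elim: h m' => [|[s' a] h IH] m'; first by rewrite /word_wgt big_nil subr0.
  rewrite /is_path_in /= => /and3P[/andP[/andP[s'E aA] hEA] tE /andP[pt ht]] m'0 fe.
  rewrite /first_state /= in fe.
  have htE : is_path_in E A h t by rewrite /is_path_in hEA tE.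
  have Wm (r : state M) b : - W <= (m' - weight r b)%:~R.
    have := weight_le r b; rewrite ler_norml intrB => /andP[_ wr].
    have : 0 < m'%:~R :> R by rewrite ltr0z.
    lra.
  have e : f (first_state h t) (m' - weight s' a) = F (s1, i1).
    apply: (@step_max (uniform_acts s') (up s') s'
      (fun a r => f r (m' - weight s' a)) _ a (first_state h t)) => //.
    - exact: uniform_distr.
    - by apply: uniform_acts_sub.1; rewrite inE.
    - move=> b r bA br; apply: f_max => //; apply: (sub_EA.2) br => //.
      by rewrite uniform_acts_E in bA.
    - by rewrite -fe; exact: f_step.
    - by apply: uniform_gt0; rewrite uniform_acts_E.
  rewrite word_wgt_cons opprD addrA; apply: IH => //.
  exact: f_pos e.
have i1_gt0 : 0 < (i1 : nat)%:Z.
  by apply: (@f_pos s1) => //; rewrite (le_trans (_ : _ <= 0)) ?oppr_le0.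
have [h [t [hEA h1 Lh]]] := climb s1E (i1 : nat)%:Z.
by have := stay h t _ hEA i1_gt0; rewrite h1 subr_gt0 => /(_ erefl); rewrite ltNge Lh.
Qed.

Lemma hit_lim1 s m : s \in E -> hit_lim s m = 1.
Proof.
move=> sE; have [m0|m0] := leP m 0; first exact: hit_lim_le0.
apply/eqP; rewrite eq_le hit_lim_le1 leNgt /=; apply/negP => lt1.
have d0 : 0 < 1 - hit_lim s m by rewrite subr_gt0.
have P0 : 0 <= climb_potential s m.
  apply: le_trans (climb_potential_ge s m); rewrite addr_ge0 ?ler0z ?(ltW m0) //.
  by apply: sumr_ge0 => s' _; exact: sumr_ge0.
(* With [P] for [climb_potential s m], this [L] turns [hit_lim_ge] into [P + 1 <= P]. *)
pose L := (climb_potential s m + 1) / (1 - hit_lim s m).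
have L0 : 0 < L by rewrite divr_gt0 // ltr_wpDl.
have := hit_lim_ge L0 sE m0; rewrite ler_pdivlMr // /L mulrC divfK ?gt_eqF //.
by rewrite gerDl ler10.
Qed.

Theorem uniform_divergent : pos_weight_divergent R E A.
Proof.
exists uniform_sched; first exact: uniform_is_scheduler_in.
move=> s sE; have [mu mu_s] := induced_measure_exists s uniform_is_scheduler.
exists mu => // n; apply/eqP; rewrite eq_le probability_le1 /=; last first.
  exact: measurable_wgt_reaches.
rewrite -(hit_lim1 n%:Z sE) -EFin_lim; last by apply/cvg_ex; eexists; exact: hit_cvg.
apply: lime_le.
  by apply/cvg_ex; eexists; apply: cvg_EFin; [exact: nearW | exact: hit_cvg].
apply: nearW => k.
exact: (hit_le_reaches sub_EA uniform_is_scheduler_in sE mu_s).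
Qed.
End UniformScheduler.

(** * Potentials in the absence of divergence *)

Lemma nsumr_eq0P (R : numDomainType) (I : finType) (P : pred I) (F : I -> R) :
    (forall i, P i -> F i <= 0) -> \sum_(i | P i) F i = 0 ->
  forall i, P i -> F i = 0.
Proof.
move=> F0 sF i Pi; apply/eqP; rewrite -oppr_eq0; apply/eqP.
apply: (psumr_eq0P (F := fun i => - F i)) Pi => [j /F0|]; first by rewrite oppr_ge0.
by rewrite sumrN sF oppr0.
Qed.

Section NoDivergence.
Variables (R : realType) (M : mdp).
Implicit Types (s t : state M) (a : act M) (h : seq (state M * act M)).
Implicit Types (E : {set state M}) (A : state M -> {set act M}).

Lemma is_path_in_cat E A h h' t : is_path_in E A h (first_state h' t) ->
  is_path_in E A h' t -> is_path_in E A (h ++ h') t.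
Proof.
rewrite /is_path_in => /and3P[hE _ hp] /and3P[h'E tE h'p].
rewrite all_cat hE h'E tE /=; elim: h hp {hE} => [//|[s a] h IH] /= /andP[pt /IH ->].
by rewrite andbT; case: h pt {IH} => [|[s' a'] h].
Qed.

Lemma connect_path_in E A s t : t \in E -> connect (edge E A) s t ->
  exists2 h, is_path_in E A h t & first_state h t = s.
Proof.
move=> tE /connectP[p]; elim: p s => [|r p IH] s /=.
  by move=> _ <-; exists [::] => //; rewrite /is_path_in /= tE.
move=> /andP[/andP[sE /exists_inP[a aA pt]] rp] tl.
have [h hEA hr] := IH r rp tl.
exists ((s, a) :: h) => //; move: hEA.
by rewrite /is_path_in /= hr sE aA pt.
Qed.

Local Notation wgt p := ((weight p.1 p.2)%:~R : R).

(** * Tightness of potentials on the support of a stationary flow *)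

Section Tight.
Hypothesis no_div : ~ exists E A, end_component E A /\ pos_weight_divergent R E A.
Variables (x : state M * act M -> R) (u : state M -> R).
Hypothesis x_stat : stationary x.
Hypothesis x_enabled : forall p, 0 < x p -> p.2 \in enabled p.1.
Hypothesis drift_ge0 : forall p, 0 < x p -> 0 <= wgt p + drift p u.

Let A s : {set act M} := [set a | 0 < x (s, a)]%SET.
Let e := edge [set: state M]%SET A.

Let inA s a : (a \in A s) = (0 < x (s, a)). Proof. by rewrite inE. Qed.

Let x_ge0 p : 0 <= x p. Proof. by case: x_stat. Qed.

Let x_eq0 p : ~~ (0 < x p) -> x p = 0.
Proof. by rewrite lt_neqAle x_ge0 andbT negbK => /eqP. Qed.

(** Tested against the indicator of [F], all drifts on the support are nonnegative and their
    weighted sum is 0, so no flow enters [F] from outside. *)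
Lemma stationary_closed (F : {set state M}) :
    (forall s a t, s \in F -> 0 < x (s, a) -> 0 < trans s a t -> t \in F) ->
  forall s a t, s \notin F -> 0 < x (s, a) -> 0 < trans s a t -> t \notin F.
Proof.
move=> clF s a t sF xsa pt; apply/negP => tF.
pose f r : R := (r \in F)%:R.
have d0 p : 0 <= x p * drift p f.
  have [xp|/x_eq0 ->] := boolP (0 < x p); last by rewrite mul0r.
  rewrite mulr_ge0 // (driftE _ (x_enabled xp)); apply: sumr_ge0 => r _.
  have [pr|/prob_eq0 ->] := boolP (0 < trans p.1 p.2 r); last by rewrite mul0r.
  rewrite mulr_ge0 ?prob_ge0 // /f; have [pF|pF] := boolP (p.1 \in F).
    by rewrite (clF _ _ _ pF _ pr) ?subrr // -surjective_pairing.
  by rewrite subr0.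
have := x_stat.2 f => /(psumr_eq0P (fun p _ => d0 p)) /(_ (s, a) isT) /eqP.
rewrite mulf_eq0 gt_eqF //= => /eqP; rewrite (driftE _ (x_enabled xsa)) /= {2}/f (negbTE sF).
move=> d_eq0; have : prob R s a t * (f t - 0) = 0.
  apply: (psumr_eq0P _ d_eq0) => // r _.
  by rewrite subr0 mulr_ge0 ?prob_ge0.
by rewrite /f tF subr0 mulr1 => /eqP; rewrite gt_eqF // prob_gt0.
Qed.

Let edgeE s t : reflect (exists2 a, 0 < x (s, a) & 0 < trans s a t) (e s t).
Proof.
rewrite /e /edge /= inE /=; apply: (iffP exists_inP) => -[a].
  by rewrite inA; exists a.
by move=> xsa pt; exists a; rewrite ?inA.
Qed.

(** The set reachable from [t] is closed, so flow cannot enter it from outside; as the edge from [s]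
    enters it, [s] belongs to it. *)
Lemma stationary_edge_sym s t : e s t -> connect e t s.
Proof.
move=> /edgeE[a xsa pt]; pose F : {set state M} := [set r | connect e t r]%SET.
have clF r b r' : r \in F -> 0 < x (r, b) -> 0 < trans r b r' -> r' \in F.
  rewrite !inE => tr xrb pr; apply: connect_trans tr _; apply: connect1.
  by apply/edgeE; exists b.
apply: contraT => sF; have := stationary_closed clF _ xsa pt.
by rewrite !inE connect0 => /(_ sF).
Qed.

Lemma stationary_connect_sym s t : connect e s t -> connect e t s.
Proof.
move=> /connectP[p]; elim: p s => [|r p IH] s /=; first by move=> _ ->.
move=> /andP[sr rp] tl; apply: connect_trans (IH r rp tl) _.
exact: stationary_edge_sym.
Qed.

Variables (s0 : state M) (a0 : act M).
Hypothesis x0 : 0 < x (s0, a0).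

Let E : {set state M} := [set t | connect e s0 t]%SET.

Let clE s a t : s \in E -> 0 < x (s, a) -> 0 < trans s a t -> t \in E.
Proof.
rewrite !inE => s0s xsa pt; apply: connect_trans s0s _; apply: connect1.
by apply/edgeE; exists a.
Qed.

Lemma stationary_end_component : end_component E A.
Proof.
split.
- by apply/finset.set0Pn; exists s0; rewrite inE connect0.
- move=> s sE; split; last first.
    by apply/fintype.subsetP => a; rewrite inA => /x_enabled.
  have [->|ns] := eqVneq s s0; first by apply/finset.set0Pn; exists a0; rewrite inA.
  have /stationary_connect_sym /connectP[[|r p] /=] : connect e s0 s by move: sE; rewrite inE.
    by move=> _ ss0; rewrite ss0 eqxx in ns.
  by move=> /andP[/edgeE[a xsa _] _] _; apply/finset.set0Pn; exists a; rewrite inA.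
- by move=> s a t sE; rewrite inA; exact: clE.
- move=> s t sE tE; have : connect e s t.
    move: sE tE; rewrite !inE => /stationary_connect_sym ss0; exact: connect_trans.
  move=> /connectP[p]; elim: p s sE => [|r p IH] s sE /=.
    by move=> _ <-; exact: connect0.
  move=> /andP[/edgeE[a xsa pr] rp] tl; apply: connect_trans (IH r (clE sE xsa pr) rp tl).
  by apply: connect1; apply/andP; split=> //; apply/exists_inP; exists a; rewrite ?inA.
Qed.

(** Flow crosses the boundary of [E] in neither direction, so cutting [f] off outside [E] changes no
    drift on the support within [E] and annihilates those outside. *)
Lemma stationary_restrict f : \sum_(p | p.1 \in E) x p * drift p f = 0.
Proof.
pose f' r := if r \in E then f r else 0.
apply: etrans (x_stat.2 f'); rewrite big_mkcond; apply: eq_bigr => p _.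
have [xp|/x_eq0 ->] := boolP (0 < x p); last by rewrite !mul0r if_same.
have xp' : 0 < x (p.1, p.2) by rewrite -surjective_pairing.
case: ifPn => pE.
  congr (_ * _); rewrite !(driftE _ (x_enabled xp)); apply: eq_bigr => r _.
  have [pr|/prob_eq0 ->] := boolP (0 < trans p.1 p.2 r); last by rewrite !mul0r.
  by rewrite /f' pE (clE pE xp' pr).
rewrite /drift big1 ?sub0r /f' ?(negbTE pE) ?oppr0 ?mulr0 // => r _.
have [pr|/prob_eq0 ->] := boolP (0 < trans p.1 p.2 r); last by rewrite !mul0r.
by rewrite (negbTE (stationary_closed clE pE xp' pr)) mulr0.
Qed.

Let ups s : set R := [set r | exists h t,
  [/\ is_path_in E A h t, first_state h t = s & r = (word_wgt h)%:~R]].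

Let best s : R := sup (ups s).

Let ups_sup s : s \in E -> has_sup (ups s).
Proof.
move=> sE; split; first by exists (word_wgt ([::] : seq (state M * act M)))%:~R, [::], s;
  rewrite /is_path_in /= sE.
have EA := stationary_end_component.
have [s1 /not_implyP[s1E /existsNP[L noL]]] : exists s1, ~ (s1 \in E -> forall L : int,
    exists h t, [/\ is_path_in E A h t, first_state h t = s1 & L <= word_wgt h]).
  apply/existsNP => climb; apply: no_div; exists E, A; split=> //.
  apply: (uniform_divergent EA (u := u)) => // r a _; rewrite inA.
  exact: drift_ge0.
(* Without divergence the weights are bounded from at least one state [s1]; a path [h1] from [s1] to
   [s] carries the bound over to [s]. *)
have [_ _ _ /(_ s1 s s1E sE) /(connect_path_in sE)[h1 h1E h1s]] := EA.
exists (L - word_wgt h1)%:~R => _ [h [t [hE ht ->]]]; rewrite ler_int lerBrDr.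
rewrite leNgt; apply/negP => lt_L; apply: noL; exists (h1 ++ h), t; split.
- by apply: is_path_in_cat => //; rewrite ht.
- by case: (h1) h1s => [|[r b] h2] //= <-.
- by rewrite /word_wgt big_cat /= addrC ltW.
Qed.

Let best_step s a t : s \in E -> 0 < x (s, a) -> 0 < trans s a t ->
  (weight s a)%:~R + best t <= best s.
Proof.
move=> sE xsa pt; have tE := clE sE xsa pt.
rewrite addrC -lerBrDr; apply: ge_sup; first by case: (ups_sup tE).
move=> _ [h [r [hE ht ->]]]; rewrite lerBrDr -intrD addrC.
apply: ub_le_sup; first by case: (ups_sup sE).
exists ((s, a) :: h), r; split=> //; last by rewrite word_wgt_cons.
by move: hE; rewrite /is_path_in /= sE inA xsa ht pt.
Qed.

(** The total weight [S] of the flow on [E] is unchanged by adding the drift of any function. With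
    [u] this shows [0 <= S], with [best] it shows [S <= 0], so all terms of both sums vanish. For
    [best] the terms are sums of nonpositive increments, hence it is tight along every transition.
    The difference [u - best] has drift 0, is constant by the maximum principle on the connected set
    [E], and [u] inherits tightness. *)
Lemma stationary_tight_at t : 0 < trans s0 a0 t ->
  (weight s0 a0)%:~R + u t - u s0 = 0.
Proof.
have s0E : s0 \in E by rewrite inE connect0.
pose S := \sum_(p | p.1 \in E) x p * wgt p.
have SE f : S = \sum_(p | p.1 \in E) x p * (wgt p + drift p f).
  by under eq_bigr do rewrite mulrDr; rewrite big_split /= stationary_restrict addr0.
have u_ge0 p : p.1 \in E -> 0 <= x p * (wgt p + drift p u).
  move=> _; have [xp|/x_eq0 ->] := boolP (0 < x p); last by rewrite mul0r.
  by rewrite mulr_ge0 ?drift_ge0.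
have bestE p : 0 < x p -> wgt p + drift p best =
    \sum_t prob R p.1 p.2 t * (wgt p + best t - best p.1).
  move=> xp; rewrite (driftE _ (x_enabled xp)) -[X in X + _ = _]mul1r.
  rewrite -[X in X * _ + _](prob_sum R (x_enabled xp)) mulr_suml -big_split.
  by apply: eq_bigr => r _ /=; rewrite -mulrDr addrA.
have best_le0 p r : p.1 \in E -> 0 < x p ->
    prob R p.1 p.2 r * (wgt p + best r - best p.1) <= 0.
  move=> pE xp; have [pr|/prob_eq0 ->] := boolP (0 < trans p.1 p.2 r); last by rewrite mul0r.
  rewrite mulr_ge0_le0 ?prob_ge0 // subr_le0 best_step //.
  by rewrite -surjective_pairing.
have best_le0' p : p.1 \in E -> x p * (wgt p + drift p best) <= 0.
  move=> pE; have [xp|/x_eq0 ->] := boolP (0 < x p); last by rewrite mul0r.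
  by rewrite mulr_ge0_le0 // bestE //; apply: sumr_le0 => r _; exact: best_le0.
have S0 : S = 0.
  apply/eqP; rewrite eq_le; apply/andP; split.
    by rewrite (SE best); apply: sumr_le0 => p; exact: best_le0'.
  by rewrite (SE u); apply: sumr_ge0 => p; exact: u_ge0.
have u0 p : p.1 \in E -> 0 < x p -> wgt p + drift p u = 0.
  move=> pE xp; have := SE u; rewrite S0 => /esym /(psumr_eq0P u_ge0) /(_ p pE) /eqP.
  by rewrite mulf_eq0 gt_eqF //= => /eqP.
have best0 p : p.1 \in E -> 0 < x p -> wgt p + drift p best = 0.
  move=> pE xp; have := SE best; rewrite S0 => /esym /(nsumr_eq0P best_le0') /(_ p pE) /eqP.
  by rewrite mulf_eq0 gt_eqF //= => /eqP.
have best_tight p r : p.1 \in E -> 0 < x p -> 0 < trans p.1 p.2 r ->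
    wgt p + best r - best p.1 = 0.
  move=> pE xp pr; have := best0 p pE xp; rewrite bestE //.
  move=> /(nsumr_eq0P (fun r _ => best_le0 p r pE xp)) /(_ r isT) /eqP.
  by rewrite mulf_eq0 gt_eqF ?prob_gt0 //= => /eqP.
pose g r := u r - best r.
have g_step p r : p.1 \in E -> 0 < x p -> (forall t, t \in E -> g t <= g p.1) ->
    0 < trans p.1 p.2 r -> g r = g p.1.
  move=> pE xp gmax pr; have dg : drift p g = 0.
    have := driftDZ p u (-1) best; have := u0 p pE xp; have := best0 p pE xp.
    rewrite (_ : (fun t => u t + -1 * best t) = g); first by move: (drift _ _) => ?; lra.
    by apply/funext => t'; rewrite mulN1r.
  move: dg; rewrite (driftE _ (x_enabled xp)) => /nsumr_eq0P H.
  have /eqP : prob R p.1 p.2 r * (g r - g p.1) = 0; last first.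
    by rewrite mulf_eq0 gt_eqF ?prob_gt0 //= subr_eq0 => /eqP.
  apply: H => // q _.
  have [pq|/prob_eq0 ->] := boolP (0 < trans p.1 p.2 q); last by rewrite mul0r.
  rewrite mulr_ge0_le0 ?prob_ge0 // subr_le0 gmax //.
  by apply: clE pE _ pq; rewrite -surjective_pairing.
have [s1 s1E gmax] := @arg_maxP _ _ _ s0 (mem E) g s0E.
have gcst r : connect (edge E A) s1 r -> g r = g s1.
  move=> /connectP[p]; elim/last_ind: p r => [|p r' IH] r /=; first by move=> _ ->.
  rewrite rcons_path last_rcons => /andP[pp /andP[lE /exists_inP[a]]].
  rewrite inA => xla pr ->; have gl := IH _ pp erefl.
  rewrite -gl; apply: (g_step (last s1 p, a)) => // t' t'E.
  by rewrite gl; exact: gmax.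
move=> pt; have tE := clE s0E x0 pt.
have [_ _ _ conn] := stationary_end_component.
have := gcst t (conn _ _ s1E tE); have := gcst s0 (conn _ _ s1E s0E).
have := best_tight (s0, a0) t s0E x0 pt; rewrite /g /=; lra.
Qed.
End Tight.

Hypothesis no_div : ~ exists E A, end_component E A /\ pos_weight_divergent R E A.

Let pairs : {set state M * act M} := [set p | p.2 \in enabled p.1]%SET.

Let pairsE p : (p \in pairs) = (p.2 \in enabled p.1). Proof. by rewrite inE. Qed.

Lemma stationary_tight (x : state M * act M -> R) (u : state M -> R) : stationary x ->
    (forall p, p \notin pairs -> x p = 0) ->
    (forall p, 0 < x p -> 0 <= wgt p + drift p u) ->
  forall p t, 0 < x p -> 0 < trans p.1 p.2 t -> wgt p + u t - u p.1 = 0.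
Proof.
move=> xs xQ du [s a] t /= xsa pt.
apply: (stationary_tight_at no_div xs _ du xsa pt) => p xp.
by rewrite -pairsE; apply: contraLR xp => /xQ ->; rewrite ltxx.
Qed.
(* If no potential has nonnegative drift on the support of [x], then Farkas'
   lemma gives a stationary [y] of negative weight, and subtracting a multiple
   of [y] from [x] shrinks the support. *)
Lemma no_positive_stationary n (x : state M * act M -> R) : stationary x ->
    (forall p, p \notin pairs -> x p = 0) -> 0 < \sum_p x p * wgt p ->
  (#|[set p | (0 < x p)%R]%SET| < n)%N -> False.
Proof.
elim: n x => [//|n IH] x xs xQ xw; rewrite ltnS => xn.
pose Q := [set p | (0 < x p)%R]%SET.
have [[u uQ]|[y [ys yQ yw]]] := potential_or_stationary Q (fun p => - wgt p).
  have du p : 0 < x p -> 0 <= wgt p + drift p (fun t => -1 * u t).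
    move=> xp; have := uQ p; rewrite inE => /(_ xp); rewrite driftZ; lra.
  have tight := stationary_tight xs xQ du.
  (* Tightness on the support forces the total weight of [x] to be 0, against [xw]. *)
  have : \sum_p x p * (wgt p + drift p (fun t => -1 * u t)) = 0.
    rewrite big1 // => p _; have [xp|xp] := boolP (0 < x p); last first.
      by rewrite (_ : x p = 0) ?mul0r //; apply/eqP; rewrite eq_le xs.1 andbT leNgt.
    have p_s : p.2 \in enabled p.1.
      by rewrite -pairsE; apply: contraLR xp => /xQ ->; rewrite ltxx.
    rewrite (driftE _ p_s) -[X in X + _]mul1r -[X in X * _ + _](prob_sum R p_s) mulr_suml.
    rewrite -big_split /= big1 ?mulr0 // => r _; rewrite -mulrDr addrA.
    have [pr|/prob_eq0 ->] := boolP (0 < trans p.1 p.2 r); last by rewrite mul0r.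
    by rewrite tight // mulr0.
  under eq_bigr do rewrite mulrDr; rewrite big_split /= xs.2 addr0 => e.
  by rewrite e ltxx in xw.
have [p0 yp0] : exists p, 0 < y p.
  apply: contrapT => /forallNP y0; move: yw; rewrite big1 ?ltxx // => p _.
  have := y0 p => /negP; rewrite -leNgt => yp.
  by rewrite (_ : y p = 0) ?mul0r //; apply/eqP; rewrite eq_le yp ys.1.
(* The ratio test of the simplex method: [k] is the largest multiple of [y] that can be subtracted
   from [x], and it removes [p1] from the support. *)
have [p1 yp1 minp] := @arg_minP _ _ _ p0 (fun p => 0 < y p) (fun p => x p / y p) yp0.
set k := x p1 / y p1 in minp; have k0 : 0 <= k by rewrite divr_ge0 ?xs.1 ?ys.1.
pose z p := x p - k * y p.
have z0 p : 0 <= z p.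
  rewrite subr_ge0; have [yp|] := ltP 0 (y p); first by rewrite -ler_pdivlMr // minp.
  by move=> yp; rewrite (le_trans _ (xs.1 p)) // mulr_ge0_le0.
have xp1 : 0 < x p1.
  apply: contraLR yp1 => nx; rewrite yQ ?ltxx // inE.
  exact: nx.
apply: (IH z) => //.
- split=> // f; rewrite (eq_bigr (fun p => x p * drift p f - k * (y p * drift p f))).
    by rewrite sumrB -mulr_sumr xs.2 ys.2 mulr0 subrr.
  by move=> p _; rewrite mulrBl mulrA.
- move=> p pQ; rewrite /z xQ // yQ ?mulr0 ?subrr // inE xQ // ltxx //.
- rewrite (eq_bigr (fun p => x p * wgt p + k * (y p * - wgt p))).
    by rewrite big_split -mulr_sumr ltr_wpDr // mulr_ge0 // ltW.
  by move=> p _; rewrite /z; ring.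
- apply: leq_trans xn; apply: proper_card; apply/fintype.properP; split.
    apply/fintype.subsetP => p; rewrite !inE => /lt_le_trans; apply.
    by rewrite /z gerBl mulr_ge0 ?ys.1.
  by exists p1; rewrite !inE // /z /k divfK ?subrr ?ltxx // gt_eqF.
Qed.

(** A potential exists because no flow has positive weight; it is taken strict wherever possible. At
    a pair that is never strict, slackness gives a flow of weight 0 through it, on whose support [u]
    has drift exactly [- wgt], and [stationary_tight] applies. *)
Theorem tight_potential : exists u : state M -> R, forall s a, a \in enabled s ->
  (weight s a)%:~R + drift (s, a) u < 0 \/
  forall t, 0 < trans s a t -> (weight s a)%:~R + u t - u s = 0.
Proof.
have [[u0 u0Q]|[x [xs xQ xw]]] := potential_or_stationary pairs (fun p => wgt p); last first.
  by case: (no_positive_stationary xs xQ xw (ltnSn _)).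
have [u uQ ustrict] := strict_potential u0Q.
exists u => s a a_s; have pQ : (s, a) \in pairs by rewrite pairsE.
have [strict|[x [xs xQ xp xw]]] := strict_or_stationary u0Q pQ; first by left; exact: (ustrict (s, a) pQ strict).
right=> t pt; apply: (stationary_tight xs xQ _ xp pt) => p xp'.
have sum0 : \sum_q x q * (wgt q + drift q u) = 0.
  by under eq_bigr do rewrite mulrDr; rewrite big_split /= xw xs.2 addr0.
have le0 q : xpredT q -> x q * (wgt q + drift q u) <= 0.
  move=> _; have [qQ|/xQ ->] := boolP (q \in pairs); last by rewrite mul0r.
  by rewrite mulr_ge0_le0 ?xs.1 ?uQ.
have /eqP := nsumr_eq0P le0 sum0 (i := p) isT.
by rewrite mulf_eq0 gt_eqF //= => /eqP ->.
Qed.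
End NoDivergence.

(** * The exponential supermartingale *)

Lemma finite_lower_bound (R : realFieldType) (I : finType) (f : I -> R) :
  exists2 c, 0 < c <= 1 & forall i, 0 < f i -> c <= f i.
Proof.
exists (\big[Num.min/1]_(i | 0 < f i) f i) => [|i fi]; last exact: bigmin_le_cond.
by rewrite bigmin_le_id andbT; apply: lt_bigmin.
Qed.

(** From [1 - x <= expR (- x)] one gets [expR x <= (1 - x)^-1], and the product of [1 - x] with the
    right-hand side is [1 + x^2 - 2 x^3], at least 1 for [x <= 1/2]. *)
Lemma expR_le_quadratic (R : realType) (x : R) : x <= 2^-1 ->
  expR x <= 1 + x + 2 * (x * x).
Proof.
move=> x_le; have x1 : 0 < 1 - x by lra.
have := expR_ge1Dx (- x); rewrite expRN => le_inv.
have : expR x * (1 - x) <= 1.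
  by have := ler_wpM2l (expR_ge0 x) le_inv; rewrite mulfV // gt_eqF ?expR_gt0.
rewrite -ler_pdivlMr // => /le_trans; apply; rewrite ler_pdivrMr //; nra.
Qed.

Section Supermartingale.
Variables (R : realType) (M : mdp) (goal : state M).
Implicit Types (s t : state M) (a : act M) (past h : seq (state M * act M)).

Lemma step_action_ub (B : {set act M}) (p : act M -> R) s X c : distr_on B p ->
    (forall a, a \in B -> \sum_t prob R s a t * X a t <= c) -> step p s X <= c.
Proof.
move=> [p0 p1 pout] Xc; rewrite -[leRHS]mul1r -p1 mulr_suml; apply: ler_sum => a _.
have [aB|/pout ->] := boolP (a \in B); last by rewrite !mul0r.
by rewrite ler_wpM2l // Xc.
Qed.

Variable u : state M -> R.

Lemma exponential_rate :
    (forall s a, a \in enabled s ->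
      (weight s a)%:~R + drift (s, a) u < 0 \/
      forall t, 0 < trans s a t -> (weight s a)%:~R + u t - u s = 0) ->
  exists2 th : R, 0 < th & forall s a, a \in enabled s ->
    \sum_t prob R s a t * expR (th * ((weight s a)%:~R + u t - u s)) <= 1.
Proof.
move=> tight; pose d s a t : R := (weight s a)%:~R + u t - u s.
have dE s a : a \in enabled s ->
    \sum_t prob R s a t * d s a t = (weight s a)%:~R + drift (s, a) u.
  move=> a_s; rewrite (driftE _ (a_s : (s, a).2 \in enabled (s, a).1)) /=.
  rewrite -[X in _ = X + _]mul1r -[X in _ = X * _ + _](prob_sum R a_s) mulr_suml -big_split.
  by apply: eq_bigr => t _ /=; rewrite -mulrDr addrA.
have [eta /andP[eta0 eta1] etaP] :=
  finite_lower_bound (fun x : state M * act M => - ((weight x.1 x.2)%:~R + drift x u)).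
pose B : R := 1 + \sum_s \sum_a \sum_t `|d s a t|.
have dB s a t : `|d s a t| <= B.
  rewrite /B (bigD1 s) //= (bigD1 a) //= (bigD1 t) //=.
  have S0 (I : finType) (P : pred I) (f : I -> R) : (forall i, 0 <= f i) -> 0 <= \sum_(i | P i) f i.
    by move=> f0; apply: sumr_ge0.
  have h1 := S0 _ (fun r => r != t) (fun r => `|d s a r|) (fun=> normr_ge0 _).
  have h2 := S0 _ (fun b => b != a) (fun b => \sum_r `|d s b r|) (fun b => S0 _ _ _ (fun=> normr_ge0 _)).
  have h3 := S0 _ (fun r => r != s) (fun r => \sum_b \sum_r' `|d r b r'|)
    (fun r => S0 _ _ _ (fun b => S0 _ _ _ (fun=> normr_ge0 _))).
  lra.
have B1 : 1 <= B.
  rewrite lerDl; apply: sumr_ge0 => s _; apply: sumr_ge0 => a _.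
  by apply: sumr_ge0.
(* The quadratic error [2 * th^2 * B^2] then equals the gain [th * eta] from the negative mean, and
   [eta <= 1 <= B] gives [th * B <= 1/2], as [expR_le_quadratic] requires. *)
pose th := eta / (2 * (B * B)).
have BB : 0 < 2 * (B * B) by nra.
have th0 : 0 < th by rewrite divr_gt0.
have thB : th * (2 * (B * B)) = eta by rewrite /th divfK // gt_eqF.
exists th => // s a a_s; have [neg|zero] := tight s a a_s; last first.
  rewrite -[leRHS](prob_sum R a_s); apply: ler_sum => t _.
  have [pt|/prob_eq0 ->] := boolP (0 < trans s a t); last by rewrite mul0r.
  by rewrite zero // mulr0 expR0 mulr1.
have := etaP (s, a); rewrite /= oppr_gt0 => /(_ neg); rewrite -dE // => drift_le.
apply: (@le_trans _ _ (\sum_t prob R s a t * (1 + 2 * (th * th) * (B * B) + th * d s a t))).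
  apply: ler_sum => t _; rewrite ler_wpM2l ?prob_ge0 //.
  have := dB s a t; rewrite ler_norml => /andP[d1 d2].
  have thd : th * d s a t <= th * B by rewrite ler_wpM2l // ltW.
  have thBB : th * B <= th * (B * B) by rewrite ler_wpM2l ?(ltW th0) // ler_peMl //; lra.
  have ddB : d s a t * d s a t <= B * B by nra.
  have th2 : th * th * (d s a t * d s a t) <= th * th * (B * B) by rewrite ler_wpM2l // mulr_ge0 ?(ltW th0).
  rewrite -/(d s a t); apply: (le_trans (expR_le_quadratic _)); lra.
rewrite (eq_bigr (fun t => prob R s a t * (1 + 2 * (th * th) * (B * B)) +
  th * (prob R s a t * d s a t))); last by move=> t _; ring.
rewrite big_split /= -mulr_suml prob_sum // -mulr_sumr.
have : th * (\sum_t prob R s a t * d s a t) <= th * - eta by rewrite ler_wpM2l ?(ltW th0) // lerNr.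
have : 2 * (th * th) * (B * B) = th * eta by rewrite -thB; ring.
lra.
Qed.

(** Optional stopping at [goal]: the constant [K] collects the factor [expR (th * weight s a)] of
    each step, and the rate bounds the remaining average by 1. *)
Lemma goal_value_exp_le (sigma : sched M R) (th : R) k past s (g : int -> R) K :
    (forall s a, a \in enabled s ->
      \sum_t prob R s a t * expR (th * ((weight s a)%:~R + u t - u s)) <= 1) ->
    is_scheduler sigma -> is_path past s -> 0 <= K ->
    (forall y : int, g y <= K * expR (th * y%:~R)) ->
  goal_value goal sigma k past s g <= K * expR (th * (u s - u goal)).
Proof.
move=> rate sg; elim: k past s g K => [|k IH] past s g K ps K0 gK;
  (have [->|sgoal] := eqVneq s goal; first by
    rewrite goal_value_goal subrr mulr0; have := gK 0; rewrite mulr0).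
  by rewrite /= (negbTE sgoal) mulr_ge0 ?expR_ge0.
rewrite goal_valueS //; have := sg past s; rewrite is_path_enabled => /(_ ps) sgs.
set C := K * _; have C0 : 0 <= C by rewrite mulr_ge0 ?expR_ge0.
apply: (@le_trans _ _ (step (sigma past s) s
  (fun a t => C * expR (th * ((weight s a)%:~R + u t - u s))))).
  apply: (step_le sgs) => a t aA pt.
  have -> : C * expR (th * ((weight s a)%:~R + u t - u s)) =
      (K * expR (th * (weight s a)%:~R)) * expR (th * (u t - u goal)).
    by rewrite /C -!mulrA -!expRD; congr (_ * expR _); ring.
  apply: IH; [by rewrite is_path_rcons ps | by rewrite mulr_ge0 ?expR_ge0 |] => y.
  by rewrite -mulrA -expRD -mulrDr -intrD; exact: gK.
rewrite stepZ -[leRHS]mulr1 ler_wpM2l //.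
by apply: (step_action_ub sgs) => a; exact: rate.
Qed.
End Supermartingale.

(** * Moving towards the goal *)

Definition weight_total (M : mdp) : nat := \sum_(s : state M) \sum_a `|weight s a|%N.

Lemma weight_bound (M : mdp) (s : state M) a : (`|weight s a| <= weight_total M)%N.
Proof. by rewrite /weight_total (bigD1 s) //= (bigD1 a) //= -addnA leq_addr. Qed.

Section ShortestPath.
Variables (R : realType) (M : mdp) (goal : state M).
Hypothesis unreach_absorbing : forall s, ~~ reach s goal -> absorbing s.
Implicit Types (s t : state M) (a : act M) (past h : seq (state M * act M)).

Lemma shortest_path_strategy : exists (d : state M -> nat) (tau : state M -> act M),
  (forall s, tau s \in enabled s) /\
  forall s, reach s goal -> s != goal ->
    exists t, [/\ 0 < trans s (tau s) t, reach t goal & (d t < d s)%N].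
Proof.
pose e := edge [set: state M]%SET (@enabled M).
pose P s n := `[< exists p, [/\ path e s p, goal = last s p & size p = n] >].
have Pex s : reach s goal -> exists n, P s n.
  by move=> /connectP[p sp lp]; exists (size p); apply/asboolP; exists p.
pose d s := if pselect (exists n, P s n) is left ex then ex_minn ex else 0%N.
have dP s : reach s goal -> P s (d s) /\ forall n, P s n -> (d s <= n)%N.
  move=> /Pex ex; rewrite /d; case: pselect => [ex'|/(_ ex)//].
  by case: ex_minnP.
have next s : exists a, a \in enabled s /\ (reach s goal -> s != goal ->
    exists t, [/\ 0 < trans s a t, reach t goal & (d t < d s)%N]).
  have [sr|nr] := boolP (reach s goal); last first.
    have [a a_s] := enabled_ex s; exists a; split; first by rewrite enabledE.
    by [].
  have [sgoal|sgoal] := eqVneq s goal.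
    have [a a_s] := enabled_ex s; exists a; split; last by [].
    by rewrite enabledE.
  have [/asboolP[[|t p] /= [sp lp sz]] _] := dP s sr.
    by rewrite lp eqxx in sgoal.
  move: sp => /andP[/andP[_ /exists_inP[a a_s pt]] tp].
  have tr : reach t goal by apply/connectP; exists p.
  exists a; split=> // _ _; exists t; split=> //.
  have [_ /(_ (size p))] := dP t tr; rewrite -sz ltnS; apply.
  by apply/asboolP; exists p.
have [tau tauP] := choice next.
by exists d, tau; split=> s; have [] := tauP s.
Qed.

Definition pure (tau : state M -> act M) : sched M R := fun _ s a => (a == tau s)%:R.

Lemma pure_distr (p : act M -> R) a : p = (fun b => (b == a)%:R) -> distr_on [set a]%SET p.
Proof.
move=> ->; split=> [b||b]; first by [].
  by rewrite (bigD1 a) //= eqxx big1 ?addr0 // => b /negbTE ->.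
by rewrite inE => /negbTE ->.
Qed.

Lemma pure_is_scheduler tau : (forall s, tau s \in enabled s) -> is_scheduler (pure tau).
Proof.
move=> tau_s h t _; have [p0 p1 pout] := pure_distr (erefl (pure tau h t)).
split=> // a a_t; apply: pout; rewrite inE; apply: contraNneq a_t => ->.
exact: tau_s.
Qed.

Lemma step_pure a s X : step (fun b => (b == a)%:R) s X = \sum_t prob R s a t * X a t.
Proof.
rewrite /step (bigD1 a) //= eqxx mul1r [X in _ + X]big1 ?addr0 // => b /negbTE ->.
by rewrite mul0r.
Qed.

Definition negp (b : R) (y : int) : R := Num.max (- (y%:~R + b)) 0.
Definition posp (b : R) (y : int) : R := Num.max (y%:~R + b) 0.

Lemma negp_ge0 b y : 0 <= negp b y. Proof. by rewrite /negp le_max lexx orbT. Qed.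
Lemma posp_ge0 b y : 0 <= posp b y. Proof. by rewrite /posp le_max lexx orbT. Qed.

Lemma negp_shift b w : (fun y : int => negp b (w + y)) = negp (b + w%:~R).
Proof. by apply/funext => y; rewrite /negp intrD; congr (Num.max (- _) _); ring. Qed.

Lemma posp_shift b w : (fun y : int => posp b (w + y)) = posp (b + w%:~R).
Proof. by apply/funext => y; rewrite /posp intrD; congr (Num.max _ _); ring. Qed.

Lemma negp_le b y : negp b y <= Num.max (- b) 0 + `|y|%:~R.
Proof.
have yn : - `|y|%:~R <= y%:~R :> R by rewrite -intrN ler_int; have := ler_norm (- y); rewrite normrN; lia.
have y0 : 0 <= `|y|%:~R :> R by rewrite ler0z.
rewrite /negp ge_max addr_ge0 ?le_max ?lexx ?orbT ?andbT //.
rewrite opprD addrC lerD // ?le_max ?lexx //; lra.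
Qed.

Lemma goal_value_ge0 (sigma : sched M R) k past s g : is_scheduler sigma ->
  is_path past s -> (forall y, 0 <= g y) -> 0 <= goal_value goal sigma k past s g.
Proof.
move=> sg; elim: k past s g => [|k IH] past s g ps g0 /=; case: ifP => // _.
have := sg past s; rewrite is_path_enabled => /(_ ps) sgs.
apply: (step_lb sgs) => [//|a t aA pt]; apply: IH => //.
by rewrite is_path_rcons ps.
Qed.

Variables (d : state M -> nat) (tau : state M -> act M).
Hypothesis tau_enabled : forall s, tau s \in enabled s.
Hypothesis tau_closer : forall s, reach s goal -> s != goal ->
  exists t, [/\ 0 < trans s (tau s) t, reach t goal & (d t < d s)%N].

Local Notation W := (weight_total M).

Lemma absorbing_step s a t : absorbing s -> a \in enabled s -> 0 < trans s a t ->
  t = s /\ weight s a = 0.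
Proof.
move=> [a' [en p1 w0]]; rewrite en inE => /eqP -> pt; split=> //.
have a's : a' \in enabled s by rewrite en inE.
apply/eqP; apply: contraT => ts; have := prob_sum R a's.
rewrite (bigD1 s) //= (bigD1 t) //= {1}/prob p1 rmorph1 => /eqP.
rewrite -subr_eq0 addrAC subrr add0r; rewrite -(prob_gt0 R) in pt.
rewrite gt_eqF // ltr_pwDl // sumr_ge0 // => r _; exact: prob_ge0.
Qed.

(* The potential is an affine function of [delta ^+ d s], with [delta] below
   every transition probability. *)
Lemma expected_length : exists e : state M -> R, exists2 B : R,
  (forall s, 0 <= e s <= B) &
  forall s, s != goal ->
    `|weight s (tau s)|%:~R + \sum_t prob R s (tau s) t * e t <= e s.
Proof.
have [pm /andP[pm0 pm1] pmP] :=
  finite_lower_bound (fun x : state M * act M * state M => prob R x.1.1 x.1.2 x.2).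
(* With this half, a step towards [goal] gains [pm * (B * de ^+ (d s).-1)], twice the term
   [B * de ^+ d s] by which [e s] lies below [B]; the other half pays for the weight. *)
pose de := pm / 2; have de0 : 0 < de by rewrite divr_gt0.
have de1 : de <= 1 by rewrite /de; lra.
pose D := (\sum_s d s)%N; have dD s : (d s <= D)%N by rewrite /D (bigD1 s) //= leq_addr.
(* Chosen so that the least surplus, [B * de ^+ D * de], equals [W]. *)
pose B := W%:R / (de ^+ D * de); have deD : 0 < de ^+ D * de by rewrite mulr_gt0 ?exprn_gt0.
have B0 : 0 <= B by rewrite divr_ge0 // ltW.
have ex01 n : 0 <= de ^+ n <= 1 by rewrite exprn_ge0 ?(ltW de0) //= exprn_ile1 // (ltW de0).
(* A state that cannot reach [goal] is absorbing with weight 0 and costs nothing. *)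
pose e s := if reach s goal then B * (1 - de ^+ d s) else 0.
have eB s : 0 <= e s <= B.
  rewrite /e; case: ifP => _; last by rewrite lexx.
  have /andP[x0 x1] := ex01 (d s).
  by rewrite mulr_ge0 ?subr_ge0 //= -[leRHS]mulr1 ler_wpM2l //; lra.
exists e, B => // s sgoal; have ts := tau_enabled s.
have [sr|nr] := boolP (reach s goal); last first.
  have abs := unreach_absorbing nr.
  have [t pt] := enabled_trans ts; have [_ ->] := absorbing_step abs ts pt.
  rewrite normr0 add0r {2}/e (negbTE nr) big1 // => r _.
  have [pr|/prob_eq0 ->] := boolP (0 < trans s (tau s) r); last by rewrite mul0r.
  by have [-> _] := absorbing_step abs ts pr; rewrite /e (negbTE nr) mulr0.
have [t [pt tr dt]] := tau_closer sr sgoal.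
have pmt : pm <= prob R s (tau s) t by apply: (pmP (s, tau s, t)); rewrite /= prob_gt0.
have et : e t <= B * (1 - de ^+ (d s).-1).
  rewrite /e tr ler_wpM2l // lerD2l lerN2 ler_wiXn2l ?(ltW de0) //.
  by rewrite -ltnS (ltn_predK dt).
have sumB : \sum_r prob R s (tau s) r * e r <= B - pm * (B * de ^+ (d s).-1).
  have -> : B = \sum_r prob R s (tau s) r * B by rewrite -mulr_suml prob_sum // mul1r.
  rewrite (bigD1 t) //= [X in _ <= X - _](bigD1 t) //= addrAC; apply: lerD; last first.
    by apply: ler_sum => r _; rewrite ler_wpM2l ?prob_ge0 //; case/andP: (eB r).
  have -> : \sum_r prob R s (tau s) r * B = B by rewrite -mulr_suml prob_sum // mul1r.
  have x0 : 0 <= B * de ^+ (d s).-1 by rewrite mulr_ge0 //; case/andP: (ex01 (d s).-1).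
  apply: (@le_trans _ _ (prob R s (tau s) t * (B * (1 - de ^+ (d s).-1)))).
    by rewrite ler_wpM2l ?prob_ge0.
  rewrite mulrBr mulr1 mulrBr lerD2l lerN2; exact: ler_wpM2r.
have ds : de ^+ d s = de * de ^+ (d s).-1 by rewrite -exprS (ltn_predK dt).
have WB : W%:R <= B * de ^+ (d s).-1 * de.
  rewrite -[leLHS](divfK (lt0r_neq0 deD)) -/B -mulrA ler_wpM2l // ler_wpM2r ?(ltW de0) //.
  by rewrite ler_wiXn2l ?(ltW de0) // (leq_trans (leq_pred _)).
have wW : `|weight s (tau s)|%:~R <= W%:R :> R.
  by rewrite -[W%:R]/(W%:Z%:~R) ler_int -abszE lez_nat weight_bound.
rewrite {2}/e sr ds; have : pm = 2 * de by rewrite /de; field.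
move: sumB => /[swap] ->; set x := B * _ in WB *.
rewrite mulrBr mulr1 (_ : B * (de * _) = x * de); last by rewrite /x; ring.
move: (\sum_r _) => S; lra.
Qed.

Variables (e : state M -> R) (B : R).
Hypothesis e_bound : forall s, 0 <= e s <= B.
Hypothesis e_step : forall s, s != goal ->
    `|weight s (tau s)|%:~R + \sum_t prob R s (tau s) t * e t <= e s.

Lemma goal_value_pure_le k past s g c : 0 <= c ->
    (forall y, g y <= c + `|y|%:~R) ->
  goal_value goal (pure tau) k past s g <= c + e s.
Proof.
elim: k past s g c => [|k IH] past s g c c0 gc;
  (have [->|sgoal] := eqVneq s goal; first by
    rewrite goal_value_goal (le_trans (gc 0)) // normr0 lerD2l; case/andP: (e_bound goal)).
  by rewrite /= (negbTE sgoal) addr_ge0 //; case/andP: (e_bound s).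
rewrite goal_valueS // [step _ _ _](step_pure (tau s)).
apply: le_trans (_ : c + (`|weight s (tau s)|%:~R +
    \sum_t prob R s (tau s) t * e t) <= _); last by rewrite lerD2l e_step.
rewrite addrA -[X in X + _]mul1r -[X in X * _ + _](prob_sum R (tau_enabled s)).
rewrite mulr_suml -big_split; apply: ler_sum => t _ /=.
rewrite -mulrDr ler_wpM2l ?prob_ge0 //; apply: IH => [|y].
  by rewrite addr_ge0 // ler0z.
by rewrite (le_trans (gc _)) // -addrA lerD2l -intrD ler_int ler_normD.
Qed.

(** Only the run that comes closer to [goal] at every step is kept: it has probability at least
    [pm ^+ n] and loses weight at most [W * n], where [g] is still at least [c]. *)
Lemma goal_value_pure_ge pm n k past s g c : 0 < pm -> pm <= 1 ->
    (forall s a t, 0 < prob R s a t -> pm <= prob R s a t) ->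
    reach s goal -> (d s <= n)%N -> (n <= k)%N -> 0 <= c -> (forall y, 0 <= g y) ->
    (forall y : int, - (W * n)%N%:Z <= y -> c <= g y) ->
  pm ^+ n * c <= goal_value goal (pure tau) k past s g.
Proof.
move=> pm0 pm1 pmP; elim: n k past s g => [|n IH] k past s g sr ds nk c0 g0 gc;
  (have [->|sgoal] := eqVneq s goal; first by
    rewrite goal_value_goal (le_trans _ (gc 0 _)) ?oppr_le0 // -[leRHS]mul1r
      ler_wpM2r // exprn_ile1 // ltW).
  have [t [_ _]] := tau_closer sr sgoal.
  by move: ds; rewrite leqn0 => /eqP ->.
case: k nk => [//|k] nk; rewrite goal_valueS // [step _ _ _](step_pure (tau s)).
have [t [pt tr dt]] := tau_closer sr sgoal.
have v0 r : 0 <= prob R s (tau s) r * goal_value goal (pure tau) k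
    (rcons past (s, tau s)) r (fun x => g (weight s (tau s) + x)).
  rewrite mulr_ge0 ?prob_ge0 //.
  suff H past' k' r' g' : (forall y, 0 <= g' y) ->
      0 <= goal_value goal (pure tau) k' past' r' g' by exact: H.
  elim: k' past' r' g' => [|k' IH'] past' r' g' g'0 /=; case: ifP => // _.
  rewrite [step _ _ _](step_pure (tau r')); apply: sumr_ge0 => q _.
  by rewrite mulr_ge0 ?prob_ge0 // IH'.
rewrite (bigD1 t) //= -[leLHS]addr0 lerD ?sumr_ge0 //.
rewrite exprS -mulrA ler_pM ?(ltW pm0) ?mulr_ge0 ?exprn_ge0 ?(ltW pm0) //.
  by apply: pmP; rewrite prob_gt0.
apply: IH => //; first by rewrite -ltnS (leq_trans dt).
move=> y yn; apply: gc; have := weight_bound s (tau s); lia.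
Qed.
End ShortestPath.

(** * Unbounded partial expectations *)

Section Unbounded.
Variables (R : realType) (M : mdp) (goal : state M).
Hypothesis unreach_absorbing : forall s, ~~ reach s goal -> absorbing s.
Hypothesis goal_absorbing : absorbing goal.
Implicit Types (s t : state M) (a : act M) (past h : seq (state M * act M)).

(** [Q] acts as a bisimulation of pasts; it compares a scheduler composed by cases with the one it
    switches to, although their pasts may differ. *)
Lemma eq_goal_value (Q : seq (state M * act M) -> seq (state M * act M) -> state M -> Prop)
    (sigma sigma' : sched M R) :
    (forall p p' s, Q p p' s -> sigma p s = sigma' p' s) ->
    (forall p p' s a t, Q p p' s -> Q (rcons p (s, a)) (rcons p' (s, a)) t) ->
  forall k p p' s g, Q p p' s ->
    goal_value goal sigma k p s g = goal_value goal sigma' k p' s g.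
Proof.
move=> eq_s ext; elim=> [//|k IH] p p' s g Qs /=; case: ifP => // _.
rewrite (eq_s _ _ _ Qs) /step; apply: eq_bigr => a _; congr (_ * _).
by apply: eq_bigr => t _; congr (_ * _); apply: IH; exact: ext.
Qed.

(** No weight is ever gained in an absorbing state. Consequently every state of a divergent
    component differs from [goal] and can reach it. *)
Lemma divergent_not_absorbing (E : {set state M}) (A : state M -> {set act M}) x :
  end_component E A -> pos_weight_divergent R E A -> x \in E -> ~ absorbing x.
Proof.
move=> EA [sigma sg div] xE abs; have [mu mu_x /(_ 1%N)] := div x xE.
have sub := end_component_sub_mdp EA.
have hit0 k past m : is_path_in E A past x -> 0 < m -> hit sigma k past x m = 0.
  elim: k past => [|k IH] past ps m0; first by rewrite /= lt_geF.
  rewrite hitS //; apply: (step_eq_cst (sg _ _ ps)); first exact: sub.1.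
  move=> a t aA pt; have a_x := fintype.subsetP (sub.1 x xE) a aA.
  have [tx ->] := absorbing_step R abs a_x pt; subst t; rewrite subr0 IH //.
  exact: is_path_in_extend pt.
have := reaches_le sub sg xE mu_x (n := 1) (c := 0).
move=> H1 H2; have : (mu (wgt_reaches 1) <= 0%:E)%E.
  by apply: H1 => k; rewrite hit0 // /is_path_in /= xE.
by rewrite H2 lee_fin ler10.
Qed.

(** [C] is chosen before [N]: the negative part stays bounded while the positive part grows. The
    bias is quantified because a step of weight [w] turns it into [b + w]. *)
Definition unbounded_from s := forall b : R, exists C : R, forall N : R,
  exists theta : sched M R, [/\ is_scheduler theta,
    forall k, goal_value goal theta k [::] s (negp b) <= C &
    exists k, N <= goal_value goal theta k [::] s (posp b)].

Variables (d : state M -> nat) (tau : state M -> act M).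
Hypothesis tau_enabled : forall s, tau s \in enabled s.
Hypothesis tau_closer : forall s, reach s goal -> s != goal ->
  exists t, [/\ 0 < trans s (tau s) t, reach t goal & (d t < d s)%N].
Variables (e : state M -> R) (B : R).
Hypothesis e_bound : forall s, 0 <= e s <= B.
Hypothesis e_step : forall s, s != goal ->
    `|weight s (tau s)|%:~R + \sum_t prob R s (tau s) t * e t <= e s.

Let tsched : sched M R := pure R tau.

Let pure_neg k past s b : goal_value goal tsched k past s (negp b) <= Num.max (- b) 0 + B.
Proof.
apply: (@le_trans _ _ (Num.max (- b) 0 + e s)); last by rewrite lerD2l; case/andP: (e_bound s).
apply: (goal_value_pure_le tau_enabled e_bound e_step); last by move=> y; exact: negp_le.
by rewrite le_max lexx orbT.
Qed.

Let B_ge0 : 0 <= B.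
Proof. by have /andP[e0 eB] := e_bound goal; exact: le_trans eB. Qed.

Let tsched_scheduler : is_scheduler tsched := pure_is_scheduler R tau_enabled.

Lemma unbounded_from_pred s a t : 0 < trans s a t -> unbounded_from t -> unbounded_from s.
Proof.
move=> pt unb_t; have a_s := trans_enabled pt.
have [sgoal|sgoal] := eqVneq s goal.
  rewrite sgoal in a_s pt *.
  by have [<- _] := absorbing_step R goal_absorbing a_s pt.
move=> b; pose w := weight s a; have [C Ct] := unb_t (b + w%:~R).
pose C' := Num.max (- (b + w%:~R)) 0 + B.
have C'0 : 0 <= C' by rewrite addr_ge0 // le_max lexx orbT.
exists (Num.max C C') => N.
(* The branch through [t] has probability [q], so [N / q] is demanded there. *)
pose q := prob R s a t; have q0 : 0 < q by rewrite prob_gt0.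
have [theta' [sch' neg' [k pos']]] := Ct (N / q).
(* Play [a] once; after moving to [t], start [theta'] with the first letter of the past forgotten;
   after any other successor head for [goal]. *)
pose theta : sched M R := fun h r =>
  if h is y :: h' then (if first_state h' r == t then theta' h' r else tsched h r)
  else fun b => (b == (if r == s then a else tau r))%:R.
have sch : is_scheduler theta.
  move=> [|y h] r; rewrite is_path_enabled => hr.
    set c := if r == s then a else tau r.
    have c_r : c \in enabled r by rewrite /c; case: eqP => [->|].
    have [p0 p1 pout] := pure_distr (erefl (fun b => (b == c)%:R : R)).
    split=> // a' a'r; apply: pout; rewrite inE; apply: contraNneq a'r => ->; exact: c_r.
  rewrite /theta; case: ifP => _; last by apply: tsched_scheduler; rewrite is_path_enabled.
  by apply: sch'; rewrite is_path_enabled; case: y hr => ? ? /= /andP[].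
have E1 l g : goal_value goal theta l [:: (s, a)] t g = goal_value goal theta' l [::] t g.
  apply: (@eq_goal_value (fun p p' r => p = (s, a) :: p' /\ first_state p' r = t)) => //.
  - by move=> p p' r [-> pr]; rewrite /theta pr eqxx.
  - by move=> p p' r a' r' [-> pr]; rewrite first_state_rcons.
have E2 l r g : r != t ->
    goal_value goal theta l [:: (s, a)] r g = goal_value goal tsched l [::] r g.
  move=> rt; apply: (@eq_goal_value (fun p p' r => p = (s, a) :: p' /\ first_state p' r != t)).
  - by move=> p p' r' [-> /negbTE pr]; rewrite /theta pr.
  - by move=> p p' r' a' r'' [-> pr]; rewrite first_state_rcons.
  - by split.
have E3 l g : goal_value goal theta l.+1 [::] s g =
    \sum_r prob R s a r * goal_value goal theta l [:: (s, a)] r (fun y => g (w + y)).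
  by rewrite goal_valueS // /theta eqxx [step _ _ _](step_pure a).
exists theta; split=> // [[|l]|].
- by rewrite /= (negbTE sgoal) le_max C'0 orbT.
- rewrite E3 negp_shift -[leRHS]mul1r -[X in _ <= X * _](prob_sum R a_s) mulr_suml.
  apply: ler_sum => r _; rewrite ler_wpM2l ?prob_ge0 // le_max.
  have [->|rt] := eqVneq r t; first by rewrite E1 neg'.
  by rewrite E2 // pure_neg orbT.
- exists k.+1; rewrite E3 posp_shift (bigD1 t) //= -/q E1.
  rewrite (le_trans (_ : N <= q * (N / q))) //; first by rewrite mulrC divfK ?gt_eqF.
  rewrite -[leLHS]addr0 lerD ?ler_wpM2l ?(ltW q0) //; apply: sumr_ge0 => r rt.
  rewrite mulr_ge0 ?prob_ge0 // E2 //; apply: goal_value_ge0 => // y.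
  exact: posp_ge0.
Qed.

Lemma reached_word_wgt (m : int) h : m <= word_wgt h -> reached m h.
Proof.
elim/last_ind: h => [|h [s a] _] mh; first by rewrite reached_nil.
by rewrite reached_rcons mh orbT.
Qed.

Lemma unbounded_from_component (E : {set state M}) (A : state M -> {set act M}) s : end_component E A ->
  pos_weight_divergent R E A -> s \in E -> unbounded_from s.
Proof.
move=> EA div sE; have notabs x := @divergent_not_absorbing E A x EA div.
have sub := end_component_sub_mdp EA.
have toGoal x : x \in E -> reach x goal /\ x != goal.
  move=> xE; split.
    by apply: contraT => /unreach_absorbing /(notabs x xE).
  by apply/eqP => xg; apply: (notabs x xE); rewrite xg.
have [sigma sg mus] := div; have [mu mu_s mu1] := mus s sE.
have [pm /andP[pm0 pm1] pmP] :=
  finite_lower_bound (fun x : state M * act M * state M => prob R x.1.1 x.1.2 x.2).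
pose D := (\sum_s d s)%N; have dD x : (d x <= D)%N by rewrite /D (bigD1 x) //= leq_addr.
have pmD : 0 < pm ^+ D by rewrite exprn_gt0.
move=> b; exists (Num.max (- b) 0 + B) => N.
set WD : R := (weight_total M * D)%N%:R.
(* Large enough that probability 1/2 of reaching [n], times [pm ^+ D] for the way to [goal], times
   the remaining payoff [c], is at least [N]. *)
have [n n0 nX] : exists2 n, (0 < n)%N & `|2 * N / pm ^+ D| + `|WD - b| < n%:R.
  exists (Num.bound (`|2 * N / pm ^+ D| + `|WD - b|)).+1 => //.
  apply: lt_trans (archi_boundP _) _; first by rewrite addr_ge0.
  by rewrite ltr_nat.
pose c : R := n%:R - WD + b.
have c0 : 0 <= c.
  rewrite /c addrAC subr_ge0; move: (ler_norm (WD - b)) (normr_ge0 (2 * N / pm ^+ D)) nX.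
  by move: `|_| `|_| => x y; lra.
have cN : 2 * N <= pm ^+ D * c.
  rewrite [leRHS]mulrC -ler_pdivrMr //.
  move: (ler_norm (WD - b)) (ler_norm (2 * N / pm ^+ D)) nX; rewrite /c.
  by move: (2 * N / _) `|_| `|_| => x y z; lra.
(* Follow [sigma] inside the component until weight [n] has been reached once, then head for [goal]
   forever. *)
pose theta : sched M R := fun h r =>
  if is_path_in E A h r && ~~ reached n%:Z h then sigma h r else tsched h r.
have sch : is_scheduler theta.
  move=> h r hr; rewrite /theta; case: ifP => [/andP[hrE _]|_]; last exact: tsched_scheduler.
  have [p0 p1 pout] := sg h r hrE; split=> // a a_r; apply: pout; apply: contra a_r.
  by apply: fintype.subsetP; apply: sub.1; exact: is_path_in_last hrE.
have off l p r g : reached n%:Z p ->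
    goal_value goal theta l p r g = goal_value goal tsched l p r g.
  move=> np; apply: (@eq_goal_value (fun p p' _ => p = p' /\ reached n%:Z p)) => //.
  - by move=> p' _ r' [<- np']; rewrite /theta np' andbF.
  - by move=> p' _ r' a t [<- np']; rewrite reached_rcons np'.
have on p r l g : is_path_in E A p r -> ~~ reached n%:Z p ->
    goal_value goal theta l.+1 p r g = step (sigma p r) r (fun a t =>
      goal_value goal theta l (rcons p (r, a)) t (fun y => g (weight r a + y))).
  move=> pE np; have [_ rg] := toGoal r (is_path_in_last pE).
  by rewrite goal_valueS // /theta pE np.
(* Nothing is paid while [sigma] is followed, since [goal] is not in [E]; at the switch the weight
   is at least [n], hence nonnegative, so the bound for bias [b] applies. *)
have neg l p r : is_path_in E A p r -> ~~ reached n%:Z p ->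
    goal_value goal theta l p r (negp (b + (word_wgt p)%:~R)) <= Num.max (- b) 0 + B.
  elim: l p r => [|l IH] p r pE np.
    have [_ rg] := toGoal r (is_path_in_last pE).
    by rewrite /= (negbTE rg) addr_ge0 // le_max lexx orbT.
  rewrite on //; apply: (step_ub (sg _ _ pE)); first exact: sub.1 (is_path_in_last pE).
  move=> a t aA pt; rewrite negp_shift -addrA -intrD -word_wgt_rcons.
  have p'E := is_path_in_extend sub pE aA pt.
  have [np'|] := boolP (reached n%:Z (rcons p (r, a))); last exact: IH.
  rewrite off //; apply: (le_trans (pure_neg _ _ _ _)); rewrite lerD2r.
  move: np'; rewrite reached_rcons (negbTE np) /= => nw.
  have w0 : 0 <= (word_wgt (rcons p (r, a)))%:~R :> R by rewrite ler0z (le_trans _ nw).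
  by rewrite ge_max !le_max lexx orbT andbT; apply/orP; left; lra.
(* The horizon splits into [l] steps for the climb and [D] for the way to [goal]. *)
have pos l p r : is_path_in E A p r -> ~~ reached n%:Z p ->
    hit sigma l p r (n%:Z - word_wgt p) * (pm ^+ D * c) <=
    goal_value goal theta (l + D)%N p r (posp (b + (word_wgt p)%:~R)).
  elim: l p r => [|l IH] p r pE np;
    (have nw : 0 < n%:Z - word_wgt p by
      rewrite subr_gt0 ltNge; apply: contra np; exact: reached_word_wgt).
    have -> : hit sigma 0 p r (n%:Z - word_wgt p) = 0 by rewrite /= (lt_geF nw).
    rewrite mul0r; apply: goal_value_ge0 => //; last by move=> y; exact: posp_ge0.
    by case/and3P: pE.
  rewrite hitS // addSn on // mulrC -stepZ; apply: (step_le (sg _ _ pE)) => a t aA pt.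
  rewrite posp_shift -!addrA -intrD -opprD -word_wgt_rcons.
  have p'E := is_path_in_extend sub pE aA pt.
  have [np'|np'] := boolP (reached n%:Z (rcons p (r, a))); last first.
    by rewrite mulrC; exact: IH.
  move: (np'); rewrite reached_rcons (negbTE np) /= => nw'.
  rewrite hit_le0 ?subr_le0 // mulr1 off //.
  have [tg _] := toGoal t (is_path_in_last p'E).
  apply: (goal_value_pure_ge tau_closer) => //.
  - by move=> s' a' t' pr; exact: (pmP (s', a', t')).
  - exact: leq_addl.
  - by move=> y; exact: posp_ge0.
  - move=> y yD; rewrite /posp le_max; apply/orP; left; rewrite /c.
    have : n%:R <= (word_wgt (rcons p (r, a)))%:~R :> R by rewrite -[n%:R]/(n%:Z%:~R) ler_int.
    have : - WD <= y%:~R by rewrite /WD -[_%:R]/((_%:Z)%:~R) -intrN ler_int.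
    lra.
have nil : is_path_in E A [::] s by rewrite /is_path_in /= sE.
have nn : ~~ reached n%:Z ([::] : seq (state M * act M)) by rewrite /= orbF -ltNge.
have [k kh] : exists k, 2^-1 <= hit sigma k [::] s n%:Z.
  apply: contrapT => /forallNP none.
  have : (mu (wgt_reaches n) <= (2^-1)%:E)%E.
    apply: (reaches_le sub sg sE mu_s) => k; apply/ltW; rewrite ltNge; apply/negP; exact: none.
  by rewrite mu1 lee_fin; apply/negP; rewrite -ltNge; lra.
exists theta; split=> // [l|].
  by have := neg l [::] s nil nn; rewrite /word_wgt big_nil addr0.
exists (k + D)%N; have := pos k [::] s nil nn; rewrite /word_wgt big_nil subr0 addr0.
apply: le_trans; apply: (@le_trans _ _ (2^-1 * (pm ^+ D * c))); first by lra.
by apply: ler_wpM2r => //; rewrite mulr_ge0 // ltW.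
Qed.
End Unbounded.

(** * The expectation as a difference of two payoffs, and the equivalence *)

Section PartialExpectation.
Variables (R : realType) (M : mdp) (goal : state M) (b : R).

Lemma expectation_oplus (mu : probability (runs M) R) : ('E_mu[oplus goal b] =
  \int[mu]_z (payoff goal (posp b) z)%:E - \int[mu]_z (payoff goal (negp b) z)%:E)%E.
Proof.
rewrite unlock integralE; congr (_ - _)%E; apply: eq_integral => z _;
  rewrite ?funeposE ?funenegE -?EFinN -EFin_max /oplus /payoff;
  case: pselect => [ex|_]; rewrite /posp /negp ?oppr0 //;
  by rewrite /Num.max ltxx.
Qed.

Variables (sigma : sched M R) (s : state M) (mu : probability (runs M) R).
Hypotheses (sigma_sched : is_scheduler sigma) (mu_s : induces sigma s mu).

Lemma expectation_oplus_le c :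
    (forall k, goal_value goal sigma k [::] s (posp b) <= c) ->
  ('E_mu[oplus goal b] <= c%:E)%E.
Proof.
move=> le_c; rewrite expectation_oplus -[leRHS]sube0; apply: leeB.
  exact: (integral_payoff_le mu_s (@posp_ge0 R b)).
by apply: integral_ge0 => z _; rewrite lee_fin; apply: payoff_ge0 => y; exact: negp_ge0.
Qed.

Lemma expectation_oplus_ge c k :
    (forall l, goal_value goal sigma l [::] s (negp b) <= c) ->
  ((goal_value goal sigma k [::] s (posp b) - c)%:E <= 'E_mu[oplus goal b])%E.
Proof.
move=> le_c; rewrite expectation_oplus EFinB; apply: leeB.
  exact: (integral_payoff_ge mu_s goal (@posp_ge0 R b)).
exact: (integral_payoff_le mu_s (@negp_ge0 R b)).
Qed.
End PartialExpectation.

Theorem proposition5 (R : realType) (M : mdp) (goal : state M) (b : R)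
    (init_reach : forall s : state M, reach (init M) s)
    (goal_absorbing : absorbing goal)
    (fail_unique : fail_collapsed goal) :
  PE_sup goal (init M) b \is a fin_num <->
  ~ (exists (E : {set state M}) (A : state M -> {set act M}),
       end_component E A /\ pos_weight_divergent R E A).
Proof.
have [unreach_absorbing _] := fail_unique.
have [d [tau [tau_enabled tau_closer]]] := shortest_path_strategy goal.
have [e [B e_bound e_step]] := expected_length R unreach_absorbing tau_enabled tau_closer.
split=> [fin [E [A [EA div]]]|no_div].
  have unb : unbounded_from R goal (init M).
    have [/finset.set0Pn[s sE] _ _ _] := EA.
    have unb_s := unbounded_from_component unreach_absorbing goal_absorbing
      tau_enabled tau_closer e_bound e_step EA div sE.
    have /connectP[p] := init_reach s.
    elim: p (init M) => [|t p IH] r /=; first by move=> _ <-.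
    move=> /andP[/andP[_ /exists_inP[a _ pt]] tp] sl.
    exact: (unbounded_from_pred goal_absorbing tau_enabled e_bound e_step pt (IH t tp sl)).
  have [C Cb] := unb b.
  have PE_ge N : (N%:E <= PE_sup goal (init M) b)%E.
    (* The negative part takes away at most [C]. *)
    have [theta [sch neg [k pos]]] := Cb (N + C).
    have [mu mu_i] := induced_measure_exists (init M) sch.
    apply: (@le_trans _ _ ('E_mu[oplus goal b])%E).
      apply: le_trans (expectation_oplus_ge sch mu_i k neg).
      by rewrite lee_fin lerBrDr.
    by apply: ereal_sup_ubound; exists theta, mu.
  move: fin PE_ge; case: (PE_sup _ _ _) => // r _ /(_ (r + 1)).
  by rewrite lee_fin gerDl ler10.
have [u tight] := tight_potential no_div.
have [th th0 rate] := exponential_rate tight.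
rewrite fin_numE -ltNye -ltey; apply/andP; split.
  (* The supremum is not [-oo], because heading for [goal] has a negative part of finite
     expectation. *)
  have sch := pure_is_scheduler R tau_enabled.
  have [mu mu_i] := induced_measure_exists (init M) sch.
  apply: (@lt_le_trans _ _ ('E_mu[oplus goal b])%E); last first.
    by apply: ereal_sup_ubound; exists (pure R tau), mu.
  apply: lt_le_trans (expectation_oplus_ge (c := Num.max (- b) 0 + e (init M)) sch mu_i 0 _).
    exact: ltNyr.
  move=> k; apply: (goal_value_pure_le tau_enabled e_bound e_step).
    by rewrite le_max lexx orbT.
  exact: negp_le.
(* The constant comes from [z <= th^-1 * expR (th * z)] at [z = y + b], which bounds [posp b y] by a
   multiple of [expR (th * y)]. *)
apply: (@le_lt_trans _ _ (th^-1 * expR (th * b) * expR (th * (u (init M) - u goal)))%:E);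
  last exact: ltry.
apply: ge_ereal_sup => _ [sigma [mu [sch mu_i ->]]].
apply: (expectation_oplus_le sch mu_i) => k.
apply: goal_value_exp_le => //; first by rewrite mulr_ge0 ?expR_ge0 // invr_ge0 ltW.
move=> y; rewrite -mulrA -expRD -mulrDr [b + _]addrC ler_pdivlMl //.
rewrite maxr_pMr ?(ltW th0) // mulr0 ge_max expR_ge0 andbT.
by apply: le_trans (expR_ge1Dx _); rewrite lerDr.
Qed.
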